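(* Let $(X,d)$ be a metric space and $E\in\mathrm{Reg}_1(c_E)$ a subset of $X$. Then the following are equivalent: (1) $E\in\mathrm{GLem}(\kappa,1)$; (2) $E\in\mathrm{GLem}(\iota_{1,1},1)$. In fact, if $\Delta$ is a system of Christ–David dyadic cubes on the $1$-regular set $E$, then $$3^{-1}\kappa(2Q)\le\iota_{1,1}(2Q)\le C\,\kappa(7Q),\qquad Q\in\Delta,$$ where $C\ge1$ is a constant depending only on $c_E$. Moreover, if $(X,d)$ is complete, quasiconvex, and doubling, and if one (and thus both) of conditions (1) and (2) hold, then $E$ is uniformly $1$-rectifiable.
   Context: $B_r(x)$ is the open ball. A set $E\subset X$ with $\mathrm{diam}(E)>0$ is $1$-regular with constant $C\ge 1$, written $E\in\mathrm{Reg}_1(C)$, if it is closed and $C^{-1}r\le \mathcal H^1(B_r(x)\cap E)\le Cr$ for all $x\in E$, $r\in(0,2\,\mathrm{diam}(E))$ ($\mathrm{diam}(E)=+\infty$ if $E$ is unbounded). $(X,d)$ is quasiconvex if there is $L\ge1$ such that any $x,y\in X$ can be joined by a curve of length at most $L\,d(x,y)$; it is doubling if there is $D\ge1$ such that for every $\varepsilon\in(0,1/2]$ every subset of diameter $r$ can be covered by at most $\varepsilon^{-D}$ sets of diameter at most $\varepsilon r$. In a complete, doubling, quasiconvex space, a $1$-regular set is called uniformly $1$-rectifiable if it satisfies one (equivalently all) of: it is contained in a closed connected $1$-regular set; it has big pieces of Lipschitz images; it has big pieces of bi-Lipschitz images; it satisfies $\mathrm{GLem}(\kappa,1)$. Here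 big pieces of Lipschitz (resp. bi-Lipschitz) images means: there are $c,L>0$ such that for every $x\in E$ and $0<r<\mathrm{diam}(E)$ there are $A\subset(-r,r)\subset\mathbb R$ and an $L$-Lipschitz map (resp. $L$-bi-Lipschitz embedding) $f:A\to E$ with $\mathcal H^1(f(A)\cap B_r(x))\ge cr$. Dyadic systems: put $\mathbb J=\mathbb Z$ if $E$ is unbounded, and $\mathbb J=\{j\in\mathbb Z: j\ge n\}$ with $2^{-n}\le\mathrm{diam}(E)<2^{-n+1}$ if $E$ is bounded. For each $C\ge1$ there is a constant $c_0=c_0(C)\in(0,1)$ (fixed once and for all) such that every $E\in\mathrm{Reg}_1(C)$ in any metric space admits a system of (Christ–David) dyadic cubes $\Delta=\bigcup_{j\in\mathbb J}\Delta_j$, i.e. each $\Delta_j$ is a family of pairwise disjoint Borel subsets $Q\subset E$ with: $E=\bigcup_{Q\in\Delta_j}Q$ for every $j$; if $i\le j$, $Q\in\Delta_i$, $Q'\in\Delta_j$, then $Q'\subset Q$ or $Q\cap Q'=\emptyset$; for $Q'\in\Delta_j$ and $i<j$, $i\in\mathbb J$, there is a unique $Q\in\Delta_i$ with $Q'\subset Q$; $\mathrm{diam}(Q)\le c_0^{-1}2^{-j}$ for $Q\in\Delta_j$; for each $Q\in\Delta_j$ there is $x_Q\in E$ with $B_{c_02^{-j}}(x_Q)\cap E\subset Q$. For $Q_0\in\Delta$ let $\Delta_{Q_0}=\{Q\in\Delta:Q\subset Q_0\}$, and for $K>1$ let $KQ=\{x\in E:\mathrm{dist}(x,Q)\le (K-1)\mathrm{diam}(Q)\}$.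 Let $\mu=\mathcal H^1\lfloor_E$ and let $\mathcal D_1(E)$ be the family of bounded Borel subsets of $E$ of positive $\mathcal H^1$-measure. For $h:\mathcal D_1(E)\to[0,1]$ and $p\in(0,\infty)$, $E\in\mathrm{GLem}(h,p)$ means that there is a constant $M$ such that for every dyadic system $\Delta$ on $E$, $\sum_{Q\in\Delta_{Q_0}}h(2Q)^p\mu(Q)\le M\mu(Q_0)$ for all $Q_0\in\Delta$. Triangular excess: $\partial(\{x_1,x_2,x_3\})=\min_{\sigma\in S_3}\{d(x_{\sigma(1)},x_{\sigma(2)})+d(x_{\sigma(2)},x_{\sigma(3)})-d(x_{\sigma(1)},x_{\sigma(3)})\}$. For $S\in\mathcal D_1(E)$, $$\kappa(S)=\frac1{\mu(S)^3}\int_S\int_S\int_S\frac{\partial(\{x_1,x_2,x_3\})}{\mathrm{diam}(S)}\,d\mu(x_1)d\mu(x_2)d\mu(x_3),$$ $$\iota_{1,1}(S)=\inf_{\|\cdot\|}\ \inf_{f:S\to\mathbb R}\ \frac1{\mu(S)^2}\int_S\int_S\frac{|d(x,y)-\|f(x)-f(y)\||}{\mathrm{diam}(S)}\,d\mu(x)d\mu(y),$$ the infima being over all norms on $\mathbb R$ and all Borel functions $f$. *)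

(* Defs.v *)
From HB Require Import structures.
From mathcomp Require Import all_boot all_order all_algebra all_fingroup.
From mathcomp Require Import all_classical all_reals all_analysis.
Set Implicit Arguments.
Unset Strict Implicit.
Unset Printing Implicit Defensive.
Import Order.TTheory GRing.Theory Num.Theory.
Import numFieldNormedType.Exports.
Local Open Scope classical_set_scope.
Local Open Scope ring_scope.

(* The base point is only there because [measurableType] requires one. *)
#[short(type="pmetricType")]
HB.structure Definition PMetric (R : numDomainType) :=
  {X of Metric R X & Pointed X}.

Definition borel (R : realType) (X : pmetricType R) :=
  g_sigma_algebraType (@open X).

Section hausdorff.
Context (R : realType) (X : pmetricType R).
Implicit Types A B C : set X.
Local Open Scope ereal_scope.

(* The value 0 is adjoined so that the empty set has diameter 0. *)
Definition ediam A : \bar R :=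
  ereal_sup (0 |` [set (mdist xy.1 xy.2)%:E | xy in A `*` A]).

Definition diam A : R := fine (ediam A).

Definition small_cover (delta : R) A : set ((set X)^nat) :=
  [set F | A `<=` \bigcup_k F k /\ forall k, ediam (F k) <= delta%:E].

Definition hausdorff1_pre (delta : R) A : \bar R :=
  ereal_inf [set \sum_(k <oo) ediam (F k) | F in small_cover delta A].

Definition hausdorff1 (A : set (borel X)) : \bar R :=
  ereal_sup [set hausdorff1_pre delta A | delta in [set d : R | (0 < d)%R]].

Lemma ediam_ge0 A : 0 <= ediam A.
Proof. by apply: ereal_sup_ubound; left. Qed.
Hint Resolve ediam_ge0 : core.

Lemma ediam0 : ediam set0 = 0.
Proof.
apply/eqP; rewrite eq_le ediam_ge0 andbT.
by apply: ge_ereal_sup => z /= [->//|[[x y] []]].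
Qed.

Lemma mdist_le_ediam A x y : A x -> A y -> (mdist x y)%:E <= ediam A.
Proof. by move=> Ax Ay; apply: ereal_sup_ubound; right; exists (x, y). Qed.

Lemma hausdorff1_pre_ge0 d A : 0 <= hausdorff1_pre d A.
Proof. by apply: le_ereal_inf_tmp => _ [F _ <-]; exact: nneseries_ge0. Qed.

Lemma hausdorff1_preS (d e : R) A B : (d <= e)%R -> A `<=` B ->
  hausdorff1_pre e A <= hausdorff1_pre d B.
Proof.
move=> de AB; apply: ereal_inf_le_tmp => _ [F [BF Fd] <-].
exists F => //; split; first exact: subset_trans BF.
by move=> k; rewrite (le_trans (Fd k))// lee_fin.
Qed.

Lemma hausdorff1_pre0 d : (0 < d)%R -> hausdorff1_pre d set0 = 0.
Proof.
move=> d0; apply/eqP; rewrite eq_le hausdorff1_pre_ge0 andbT.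
apply: ereal_inf_lbound; exists (fun=> set0).
  by split => // k; rewrite ediam0 lee_fin ltW.
by rewrite eseries0// => i _ _; rewrite ediam0.
Qed.

Lemma hausdorff1_pre_sigma_subadditive d : sigma_subadditive (hausdorff1_pre d).
Proof.
move=> A; have [[i ioo]|] := pselect (exists i, hausdorff1_pre d (A i) = +oo).
  rewrite (eseries_pinfty _ _ ioo) ?leey// => n _.
  by rewrite -ltNye (lt_le_trans _ (hausdorff1_pre_ge0 _ _)).
rewrite -forallNE => Aoo.
suff add2e (e : {posnum R}) : hausdorff1_pre d (\bigcup_n A n) <=
    \sum_(i <oo) hausdorff1_pre d (A i) + e%:num%:E.
  by apply/lee_addgt0Pr => _/posnumP[].
rewrite (le_trans _ (epsilon_trick _ _ _))//; last first.
  by move=> n; exact: hausdorff1_pre_ge0.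
pose P n (B : (set X)^nat) := small_cover d (A n) B /\
  \sum_(k <oo) ediam (B k) <=
    hausdorff1_pre d (A n) + (e%:num / (2 ^ n.+1)%:R)%:E.
have [G PG] : {G : ((set X)^nat)^nat & forall n, P n (G n)}.
  apply: (@choice _ _ P) => n; rewrite /P /hausdorff1_pre.
  set S := (X in ereal_inf X); move infS : (ereal_inf S) => iS.
  case: iS infS => [r Sr|Soo|Soo].
  - have en1 : (0 < e%:num / (2 ^ n.+1)%:R)%R by [].
    have /(lb_ereal_inf_adherent en1) : ereal_inf S \is a fin_num by rewrite Sr.
    move=> [x [B SB muBx] xS].
    by exists B; split => //; rewrite muBx -Sr; exact/ltW.
  - by have := Aoo n; rewrite /hausdorff1_pre Soo.
  - suff : lbound S 0 by move/le_ereal_inf_tmp; rewrite Soo.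
    by move=> /= _ [B _ <-]; exact: nneseries_ge0.
have muG_ge0 x : 0 <= (ediam \o uncurry G) x by exact: ediam_ge0.
apply: (@le_trans _ _ (\esum_(i in setT) (ediam \o uncurry G) i)).
  apply: ereal_inf_lbound => /=.
  have /card_esym/ppcard_eqP[f] := card_nat2.
  exists (uncurry G \o f).
    split => [|k]; last first.
      by have := (PG (f k).1).1.2 (f k).2; rewrite /=; case: (f k).
    apply: (@subset_trans _  (\bigcup_n \bigcup_k G n k)) => [t [i _]|].
      by move=> /((PG i).1.1) -[j _ ?]; exists i => //; exists j.
    move=> t [i _ [j _ Bijt]]; exists (f^-1%FUN (i, j)) => //=.
    by rewrite invK ?inE.
  rewrite -(esum_pred_image (ediam \o uncurry G) _ xpredT) ?[fun=> _]set_true//.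
  by rewrite image_eq.
rewrite (_ : esum _ _ = \sum_(i <oo) \sum_(j <oo ) ediam (G i j)); last first.
  pose J : nat -> set (nat * nat) := fun i => [set (i, j) | j in setT].
  rewrite (_ : setT = \bigcup_k J k); last first.
    by rewrite predeqE => -[a b]; split => // _; exists a => //; exists b.
  rewrite esum_bigcupT /=; last 2 first.
    - apply/trivIsetP => i j _ _ ij.
      rewrite predeqE => -[n m] /=; split => //= -[] [_] _ [<-{n} _].
      by move=> [m' _] [] /esym/eqP; rewrite (negbTE ij).
    - by move=> /= [n m]; exact: ediam_ge0.
  rewrite -(image_id [set: nat]) -fun_true esum_pred_image//; last first.
    by move=> n _; exact: esum_ge0.
  apply: eq_eseriesr => /= j _.
  rewrite -(esum_pred_image (ediam \o uncurry G) (pair j) predT)//=; last first.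
    by move=> ? ? _ _; exact: (@can_inj _ _ _ snd).
  by congr esum; rewrite predeqE => -[a b]; split; move=> [i _ <-]; exists i.
apply: lee_lim.
- apply: is_cvg_nneseries => n *.
  by apply: nneseries_ge0 => m *; exact: (muG_ge0 (n, m)).
- apply: is_cvg_nneseries => n *; apply: adde_ge0 => //.
  exact: hausdorff1_pre_ge0.
- by near=> n; apply: lee_sum => i _; exact: (PG i).2.
Unshelve. all: by end_near. Qed.

Lemma hausdorff1_ge0 A : 0 <= hausdorff1 A.
Proof.
apply: (@le_trans _ _ (hausdorff1_pre 1 A)); first exact: hausdorff1_pre_ge0.
by apply: ereal_sup_ubound; exists 1%R => //=.
Qed.

Lemma hausdorff1_0 : hausdorff1 set0 = 0.
Proof.
apply/eqP; rewrite eq_le hausdorff1_ge0 andbT.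
by apply: ge_ereal_sup => _ [d d0 <-]; rewrite hausdorff1_pre0.
Qed.

Lemma le_hausdorff1 : {homo hausdorff1 : A B / A `<=` B >-> A <= B}.
Proof.
move=> A B AB; apply: ge_ereal_sup => _ [d d0 <-].
apply: (@le_trans _ _ (hausdorff1_pre d B)); first exact: hausdorff1_preS.
by apply: ereal_sup_ubound; exists d.
Qed.

Lemma hausdorff1_sigma_subadditive : sigma_subadditive hausdorff1.
Proof.
move=> A; apply: ge_ereal_sup => _ [d d0 <-].
apply: (le_trans (@hausdorff1_pre_sigma_subadditive d A)).
apply: lee_nneseries => [i _ _|n _]; first exact: hausdorff1_pre_ge0.
by apply: ereal_sup_ubound; exists d.
Qed.

HB.instance Definition _ := isOuterMeasure.Build R (borel X) hausdorff1
  hausdorff1_0 hausdorff1_ge0 le_hausdorff1 hausdorff1_sigma_subadditive.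

Lemma hausdorff1_pre_metric (d e : R) A B : (0 < d)%R -> (d < e)%R ->
  (forall x y, A x -> B y -> e <= mdist x y)%R ->
  hausdorff1_pre d A + hausdorff1_pre d B <= hausdorff1_pre d (A `|` B).
Proof.
move=> d0 de AB; apply: le_ereal_inf_tmp => _ [F [ABF Fd] <-].
pose G D k := if pselect (D `&` F k !=set0) then F k else set0.
have GD (D : set X) : D `<=` A `|` B ->
    hausdorff1_pre d D <= \sum_(k <oo) ediam (G D k).
  move=> DAB; apply: ereal_inf_lbound; exists (G D) => //; split.
    move=> x Dx; have [k _ Fkx] := ABF _ (DAB _ Dx); exists k => //.
    by rewrite /G; case: pselect => //; case; exists x.
  by move=> k; rewrite /G; case: pselect => /= _ //; rewrite ediam0 lee_fin ltW.
apply: (@le_trans _ _ (\sum_(k <oo) ediam (G A k) + \sum_(k <oo) ediam (G B k))).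
  by apply: leeD; apply: GD => x; [left|right].
rewrite -nneseriesD//; apply: lee_nneseries => [i _ _|k _].
  exact: adde_ge0.
rewrite /G; case: pselect => /= [[x [Ax Fx]]|_]; last first.
  by rewrite ediam0 add0e; case: pselect => //= _; rewrite ediam0.
case: pselect => /= [[y [By Fy]]|_]; last by rewrite ediam0 adde0.
have := le_trans (mdist_le_ediam Fx Fy) (Fd k).
by rewrite lee_fin leNgt (lt_le_trans de)// AB.
Qed.

Lemma hausdorff1_metric (e : R) A B : (0 < e)%R ->
  (forall x y, A x -> B y -> e <= mdist x y)%R ->
  hausdorff1 A + hausdorff1 B <= hausdorff1 (A `|` B).
Proof.
move=> e0 AB.
have [->|Hfin] := eqVneq (hausdorff1 (A `|` B)) +oo; first by rewrite leey.
have fin D : D `<=` A `|` B -> hausdorff1 D \is a fin_num.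
  move=> /le_hausdorff1 DAB; rewrite ge0_fin_numE ?hausdorff1_ge0//.
  by rewrite (le_lt_trans DAB)// ltey.
have pre (d1 d2 : R) : (0 < d1)%R -> (0 < d2)%R ->
    hausdorff1_pre d1 A + hausdorff1_pre d2 B <= hausdorff1 (A `|` B).
  move=> d10 d20; pose d := Num.min (Num.min d1 d2) (e / 2)%R.
  have d0 : (0 < d)%R by rewrite !lt_min d10 d20 divr_gt0.
  have de : (d < e)%R by rewrite gt_min ltr_pdivrMr// ltr_pMr// ltr1n orbT.
  apply: (@le_trans _ _ (hausdorff1_pre d A + hausdorff1_pre d B)).
    by apply: leeD; apply: hausdorff1_preS => //; rewrite !ge_min lexx ?orbT.
  apply: (le_trans (hausdorff1_pre_metric d0 de AB)).
  by apply: ereal_sup_ubound; exists d.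
have finpre d D : (0 < d)%R -> D `<=` A `|` B -> hausdorff1_pre d D \is a fin_num.
  move=> d0 DAB; rewrite ge0_fin_numE ?hausdorff1_pre_ge0//.
  apply: (@le_lt_trans _ _ (hausdorff1 D)).
    by apply: ereal_sup_ubound; exists d.
  by rewrite -ge0_fin_numE ?hausdorff1_ge0 ?fin.
have AS : A `<=` A `|` B by move=> x; left.
have BS : B `<=` A `|` B by move=> x; right.
rewrite -leeBrDr ?fin//; apply: ge_ereal_sup => _ [d1 d10 <-].
rewrite leeBrDr ?fin// addeC -leeBrDr ?finpre//.
apply: ge_ereal_sup => _ [d2 d20 <-].
by rewrite leeBrDr ?finpre// addeC pre.
Qed.

Lemma closed_caratheodory C : closed C -> hausdorff1.-caratheodory C.
Proof.
move=> clC; suff key (A : set X) :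
    hausdorff1 (A `&` C) + hausdorff1 (A `&` ~` C) <= hausdorff1 A.
  by apply: le_caratheodory_measurable => A; exact: key.
have [->|Hfin] := eqVneq (hausdorff1 A) +oo; first by rewrite leey.
pose V n : set X := [set x | A x /\ forall c, C c -> (n.+1%:R^-1 <= mdist x c)%R].
pose W n := V n.+1 `\` V n.
have VA n : V n `<=` A by move=> x [].
have invS n : (0 < n.+1%:R^-1 - n.+2%:R^-1 :> R)%R.
  by rewrite subr_gt0 ltf_pV2 ?posrE// ltr_nat.
have VS n : V n `<=` V n.+1.
  move=> x [Ax Vx]; split => // c /Vx; apply: le_trans.
  by rewrite ltW// -subr_gt0.
have sep n x y : V n x -> A y -> ~ V n.+1 y ->
    (n.+1%:R^-1 - n.+2%:R^-1 <= mdist x y)%R.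
  move=> [Ax Vx] Ay /not_andP[//|/existsNP[c /not_implyP[Cc /negP]]].
  rewrite -ltNge => yc; rewrite lerBlDr.
  rewrite (le_trans (Vx _ Cc))// (le_trans (metric_triangle x y c))//.
  by rewrite lerD2l ltW.
have sepVW n : hausdorff1 (V n) + hausdorff1 (W n.+1) <= hausdorff1 (V n.+2).
  apply: le_trans (le_hausdorff1 (_ : V n `|` W n.+1 `<=` V n.+2)).
    apply: (hausdorff1_metric (invS n)) => x y Vx [Vy nVy].
    by apply: sep => //; exact: VA Vy.
  by move=> x [/VS/VS//|[]].
have sepVC n : hausdorff1 (A `&` C) + hausdorff1 (V n) <= hausdorff1 A.
  rewrite addeC; apply: le_trans (le_hausdorff1 (_ : V n `|` (A `&` C) `<=` A)).
    apply: (@hausdorff1_metric n.+1%:R^-1%R); first by rewrite invr_gt0.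
    by move=> x y [_ Vx] [_ Cy]; exact: Vx.
  by move=> x [/VA|[]].
have ACE n : A `&` ~` C `<=` V n `|` \bigcup_k W (k + n)%N.
  move=> x [Ax nCx].
  have [e /= e0 xe] : nbhs_ball x (~` C).
    by rewrite nbhs_ballE; apply: open_nbhs_nbhs; split => //; exact: closed_openC.
  have [m Vm] : exists m, V m x.
    have [m me] : exists m : nat, (m.+1%:R^-1 < e)%R.
      exists (Num.truncn e^-1); rewrite invf_plt ?posrE//.
      by rewrite truncnS_gt.
    exists m; split => // c Cc; rewrite leNgt; apply/negP => xc.
    by apply: (xe c) => //; rewrite ballEmdist /= (lt_trans xc).
  elim: m Vm => [|m IH] Vm; first by left; elim: n => [//|n]; exact: VS.
  have [/IH//|nVm] := pselect (V m x).
  have [mn|nm] := ltnP m n.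
    left; rewrite -(subnK mn); elim: (n - m.+1)%N => [//|k]; exact: VS.
  by right; exists (m - n)%N => //; rewrite subnK.
pose u n := hausdorff1 (W n.+1).
have u0 n : 0 <= u n by exact: hausdorff1_ge0.
have odds b N : \sum_(k < N) u (k.*2 + b)%N <= hausdorff1 A.
  apply: (@le_trans _ _ (hausdorff1 (V (N.*2 + b)%N))); last first.
    exact/le_hausdorff1/VA.
  elim: N => [|N IH]; first by rewrite big_ord0 hausdorff1_ge0.
  rewrite big_ord_recr/= doubleS !addSn.
  by apply: le_trans (sepVW _); exact: leeD.
have sums N : \sum_(k < N.*2) u k =
    \sum_(k < N) u (k.*2 + 0)%N + \sum_(k < N) u (k.*2 + 1)%N.
  elim: N => [|N IH]; first by rewrite !big_ord0 adde0.
  rewrite doubleS !big_ord_recr/= IH addn0 addn1 -!addeA; congr (_ + _).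
  by rewrite addeCA.
have ubu N : \sum_(0 <= k < N) u k <= hausdorff1 A + hausdorff1 A.
  apply: (@le_trans _ _ (\sum_(0 <= k < N.*2) u k)).
    by apply: lee_sum_nneg_natr => //; rewrite -addnn leq_addr.
  by rewrite big_mkord sums leeD.
have Afin : hausdorff1 A \is a fin_num.
  by rewrite ge0_fin_numE ?hausdorff1_ge0// ltey.
have usum : \sum_(k <oo) u k < +oo.
  apply: (@le_lt_trans _ _ (hausdorff1 A + hausdorff1 A)); last first.
    by rewrite ltey_eq fin_numD Afin.
  apply: lime_le; first exact: is_cvg_nneseries.
  by apply: nearW => N; exact: ubu.
have tail := nneseries_tail_cvg usum (fun k _ => u0 k).
have main n : hausdorff1 (A `&` C) + hausdorff1 (A `&` ~` C) <=
    hausdorff1 A + \sum_(n <= k <oo) u k.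
  have : hausdorff1 (A `&` ~` C) <=
      hausdorff1 (V n.+1) + \sum_(n <= k <oo) u k.
    apply: (le_trans (le_hausdorff1 (ACE n.+1))).
    apply: (le_trans (outer_measureU2 _ _ _)); rewrite leeD2l//.
    apply: (le_trans (hausdorff1_sigma_subadditive _)).
    rewrite -nneseries_addn//; apply: lee_nneseries => [i _ _|i _].
      exact: hausdorff1_ge0.
    by rewrite /u addnS.
  move=> H; apply: (le_trans (leeD2l _ H)).
  by rewrite addeA leeD2r.
have : (fun n => hausdorff1 A + \sum_(n <= k <oo) u k) @ \oo --> hausdorff1 A + 0.
  by apply: cvgeD => //; [rewrite fin_num_adde_defr|exact: cvg_cst].
rewrite adde0 => lim; rewrite -(cvg_lim _ lim)//.
apply: lime_ge; first by apply/cvg_ex; exists (hausdorff1 A).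
by apply: nearW.
Qed.

Lemma measurable_caratheodory (A : set (borel X)) :
  measurable A -> hausdorff1.-caratheodory A.
Proof.
apply: smallest_sub A; last first.
  move=> A oA; rewrite -[A]setCK; apply: caratheodory_measurable_setC.
  by apply: closed_caratheodory; exact: open_closedC.
split; first exact: caratheodory_measurable_set0.
  by move=> A cA; rewrite setTD; exact: caratheodory_measurable_setC.
by move=> F cF; exact: caratheodory_measurable_bigcup.
Qed.

Lemma hausdorff1_sigma_additive : semi_sigma_additive hausdorff1.
Proof.
move=> F mF tF mUF; apply: (@caratheodory_measure_sigma_additive R (borel X)
  hausdorff1 F) => //; first by move=> i; exact: measurable_caratheodory.
exact: measurable_caratheodory.
Qed.

HB.instance Definition _ := isMeasure.Build _ (borel X) R hausdorff1
  hausdorff1_0 hausdorff1_ge0 hausdorff1_sigma_additive.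

End hausdorff.

Section metric_notions.
Context (R : realType) (X : pmetricType R).

Definition complete_space := forall F : set_system X,
  ProperFilter F -> cauchy F -> cvg F.

Definition curve_length (g : R -> X) (a b : R) : \bar R :=
  ereal_sup [set (\sum_(0 <= n < size s)
      mdist (g (nth b (a :: s) n)) (g (nth b (a :: s) n.+1)))%:E
    | s in itv_partition a b].

Definition quasiconvex := exists2 L : R, 1 <= L &
  forall x y : X, exists g : R -> X,
    [/\ {within `[0, 1], continuous g}, g 0 = x, g 1 = y &
        (curve_length g 0 1 <= (L * mdist x y)%:E)%E].

Definition doubling := exists2 D : R, 1 <= D &
  forall (eps : R) (A : set X) (r : R), 0 < eps <= 2^-1 -> ediam A = r%:E ->
    exists (N : nat) (F : 'I_N -> set X),
      [/\ N%:R <= eps `^ (- D), A `<=` \bigcup_i F i &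
          forall i, (ediam (F i) <= (eps * r)%:E)%E].

Definition Reg1 (C : R) (E : set X) :=
  [/\ 1 <= C, (0 < ediam E)%E, closed E &
      forall (x : X) (r : R), E x -> 0 < r -> (r%:E < 2%:E * ediam E)%E ->
        ((C^-1 * r)%:E <= hausdorff1 (ball x r `&` E) <= (C * r)%:E)%E].

Definition lipschitz_on_set (L : R) (A : set R) (f : R -> X) :=
  forall s t, A s -> A t -> mdist (f s) (f t) <= L * `|s - t|.

Definition bilipschitz_on_set (L : R) (A : set R) (f : R -> X) :=
  forall s t, A s -> A t ->
    L^-1 * `|s - t| <= mdist (f s) (f t) <= L * `|s - t|.

Definition big_pieces (P : R -> set R -> (R -> X) -> Prop) (E : set X) :=
  exists c L : R, [/\ 0 < c, 0 < L &
    forall (x : X) (r : R), E x -> 0 < r -> (r%:E < ediam E)%E ->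
      exists (A : set R) (f : R -> X),
        [/\ A `<=` `](- r), r[, f @` A `<=` E, P L A f &
            ((c * r)%:E <= hausdorff1 (f @` A `&` ball x r))%E]].

End metric_notions.

Section dyadic.
Context (R : realType) (X : pmetricType R).
Implicit Types (E Q : set X) (Delta : int -> set (set X)).

Definition generations E : set int := [set j | ediam E = +oo%E \/
  exists2 n : int,
    (((2 : R) ^ (- n))%:E <= ediam E < ((2 : R) ^ (- n + 1))%:E)%E & n <= j].

Record dyadic_system (c : R) E Delta : Prop := DyadicSystem {
  dyadic_borel : forall j Q, generations E j -> Delta j Q ->
    Q `<=` E /\ measurable (Q : set (borel X)) ;
  dyadic_disjoint : forall j, generations E j -> trivIset (Delta j) id ;
  dyadic_cover : forall j, generations E j -> E = \bigcup_(Q in Delta j) Q ;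
  dyadic_nested : forall i j Q Q', generations E i -> generations E j ->
    i <= j -> Delta i Q -> Delta j Q' -> Q' `<=` Q \/ Q `&` Q' = set0 ;
  dyadic_parent : forall i j Q', generations E i -> generations E j ->
    i < j -> Delta j Q' -> exists! Q, Delta i Q /\ Q' `<=` Q ;
  dyadic_diam : forall j Q, generations E j -> Delta j Q ->
    (ediam Q <= (c^-1 * 2 ^ (- j))%:E)%E ;
  dyadic_ball : forall j Q, generations E j -> Delta j Q ->
    exists2 xQ, E xQ & ball xQ (c * 2 ^ (- j)) `&` E `<=` Q }.

Definition cubes E Delta : set (set X) :=
  \bigcup_(j in generations E) Delta j.

Definition subcubes E Delta Q0 : set (set X) :=
  [set Q | cubes E Delta Q /\ Q `<=` Q0].

Definition infdist (x : X) Q : \bar R :=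
  ereal_inf [set (mdist x y)%:E | y in Q].

Definition dilate E (K : R) Q : set X :=
  [set x | E x /\ (infdist x Q <= ((K - 1) * diam Q)%:E)%E].

(* [c] is the constant of the admitted dyadic systems. Cubes are subsets of
   [E], so their measure under the restriction of H^1 to [E] is [hausdorff1].
   Only the values of [h] at bounded Borel subsets of [E] of positive measure
   matter. *)
Definition GLem (c : R) E (h : set X -> \bar R) (p : R) :=
  exists M : R, forall Delta, dyadic_system c E Delta ->
    forall Q0, cubes E Delta Q0 ->
      (\esum_(Q in subcubes E Delta Q0) (h (dilate E 2 Q) `^ p * hausdorff1 Q)
        <= M%:E * hausdorff1 Q0)%E.

End dyadic.

(* The constant [c0 C] of the Christ-David dyadic systems on the sets of
   Reg_1(C), chosen uniformly over all metric spaces. *)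
Definition dyadic_constants (R : realType) (c0 : R -> R) :=
  forall C : R, 1 <= C -> 0 < c0 C < 1 /\
    forall (X : pmetricType R) (E : set X), Reg1 C E ->
      exists Delta, dyadic_system (c0 C) E Delta.

Section coefficients.
Context (R : realType) (X : pmetricType R).
Implicit Types S : set X.

Definition excess (x1 x2 x3 : X) : R :=
  let x := tnth [tuple x1; x2; x3] in
  let e (s : 'S_3) := mdist (x (s 0)) (x (s 1)) + mdist (x (s 1)) (x (s 2))
    - mdist (x (s 0)) (x (s 2)) in
  \big[Num.min/e 1%g]_(s : 'S_3) e s.

(* The integrals over [S] of the restriction of H^1 to [E] and of H^1 coincide
   for [S] contained in [E]. *)
Definition kappa S : \bar R :=
  (((fine (hausdorff1 S)) ^+ 3)^-1%:E *
    \int[@hausdorff1 R X]_(x1 in S) \int[@hausdorff1 R X]_(x2 in S)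
      \int[@hausdorff1 R X]_(x3 in S) (excess x1 x2 x3 / diam S)%:E)%E.

Record is_norm (N : R -> R) : Prop := IsNorm {
  norm_separated : forall x, N x = 0 -> x = 0 ;
  norm_homogeneous : forall a x, N (a * x) = `|a| * N x ;
  norm_subadditive : forall x y, N (x + y) <= N x + N y }.

(* A Borel function on a Borel set [S] is a total function that is measurable
   on [S]; its values outside [S] are irrelevant. *)
Definition iota11 S : \bar R :=
  ereal_inf [set
    ereal_inf [set
      (((fine (hausdorff1 S)) ^+ 2)^-1%:E *
        \int[@hausdorff1 R X]_(x in S) \int[@hausdorff1 R X]_(y in S)
          (`|mdist (x : X) (y : X) - N (f x - f y)| / diam S)%:E)%E
      | f in [set f : borel X -> R | measurable_fun (S : set (borel X)) f]]
    | N in is_norm].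

End coefficients.

(* Meant for a 1-regular set in a complete, doubling, quasiconvex space, where
   it is a theorem that the four conditions are equivalent. *)
Definition uniformly_1_rectifiable (R : realType) (X : pmetricType R)
    (c : R) (E : set X) :=
  [\/ exists (C : R) (F : set X), [/\ Reg1 C F, connected F & E `<=` F],
      big_pieces (@lipschitz_on_set R X) E,
      big_pieces (@bilipschitz_on_set R X) E |
      GLem c E (@kappa R X) 1].

(* Main.v *)
Require Import Defs.
From mathcomp Require Import all_boot all_order all_algebra all_fingroup.
From mathcomp Require Import all_classical all_reals all_analysis.
From mathcomp Require Import measurable_realfun ring lra.
Set Implicit Arguments.
Unset Strict Implicit.
Unset Printing Implicit Defensive.
Import Order.TTheory GRing.Theory Num.Theory.
Import numFieldNormedType.Exports.
Local Open Scope classical_set_scope.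
Local Open Scope ring_scope.

(** Lower bound for iota: for any reals f(x1), f(x2), f(x3), the excess of a
    triple is at most the sum of the three errors |d(xi,xj) - |f(xi) - f(xj)||,
    since one of the differences is the sum of the other two; integrate.

    Upper bound: it holds with kappa of any T between 2Q and 7Q, in particular
    with T = 2Q, which yields the equivalence of (1) and (2) at once. Fix base
    points x0, x1 in T at distance at least rho, a small multiple of mu(T), and
    let f be the distance to x0 signed by the side of x0 seen from x1. For any
    z at distance at least rho from x0, x1, x, y, the error of f at (x, y) is at
    most a constant times the sum of the excesses of the ten triples of
    {x0, x1, x, y, z}. By upper regularity balls of radius rho have measure at
    most mu(T)/8, so at least half of all z, and half of all x1, are admissible;
    integrating over z, y, x, x1, x0 turns each of the ten terms into
    mu(T)^2 times the triple integral defining kappa. *)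

(** * Nearly collinear quintuples *)

Ltac split_norms := repeat match goal with
  |- context [ @Num.norm _ _ ?x ] =>
    have [/[dup] ? /ger0_norm ->|/[dup] ? /ltr0_norm ->] := lerP 0 x
  end.

Section four_points.
Context (R : realFieldType).
Implicit Types a u v d f g h del : R.

(** The excess as a function of the three side lengths: by symmetry of the distance, the six
    permutations give only three values. *)
Definition tri_excess a u v : R :=
  Num.min (a + u - v) (Num.min (u + v - a) (v + a - u)).

(* [u] and [v] are the distances of a point to two base points at distance [a];
   the point is beyond the first one when [v] is the longest of the three. *)
Definition signed_coord a u v : R := if (u <= v) && (a <= v) then - u else u.

Lemma tri_excess_le a u v del : tri_excess a u v <= del ->
  [\/ a + u <= v + del, u + v <= a + del | v + a <= u + del].
Proof.
rewrite /tri_excess !ge_min => /orP[H|/orP[]H];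
  [constructor 1|constructor 2|constructor 3]; lra.
Qed.

Lemma tri_excessC a u v : tri_excess a u v = tri_excess a v u.
Proof.
by rewrite /tri_excess minA minC [Num.min (a + u - v) _]minC; congr Num.min;
  [|congr Num.min]; lra.
Qed.

Lemma tri_excess_rot a u v : tri_excess a u v = tri_excess u v a.
Proof. by rewrite /tri_excess minC -minA. Qed.

Lemma norm_signed_coord a u v : 0 <= u -> `|signed_coord a u v| = u.
Proof.
by move=> u0; rewrite /signed_coord; case: ifP => _; rewrite ?normrN ger0_norm.
Qed.

(** The sign is chosen so that the real points 0, [a] and the coordinate have the same longest side
    as the triangle; up to the excess, that side is the sum of the other two. *)
Lemma signed_coord_dist a u v del : 0 <= a -> 0 <= u -> 0 <= v ->
  a <= u + v -> u <= a + v -> v <= a + u -> tri_excess a u v <= del ->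
  `|v - `|signed_coord a u v - a| | <= del.
Proof.
move=> a0 u0 v0 h1 h2 h3 /tri_excess_le H; rewrite /signed_coord.
have [uv|uv] /= := lerP u v; last first.
  by move: H; split_norms; case; lra.
have [av|av] := lerP a v; by move: H; split_norms; case; lra.
Qed.

(** Small excess puts [d] close to |f| + |g| or to ||f| - |g||. These two numbers are |f - g| and |f
    + g|, in an order that depends on the signs. *)
Lemma tri_excess_coord u v f g d del e :
  `|u - `|f| | <= e -> `|v - `|g| | <= e ->
  d <= u + v -> u <= d + v -> v <= d + u -> tri_excess u v d <= del ->
  `|d - `|f - g| | <= del + e + e \/ `|d - `|f + g| | <= del + e + e.
Proof.
move=> uf vg h1 h2 h3 /tri_excess_le H.
have [du|du] : `|d - (`|f| + `|g|)| <= del + e + e \/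
    `|d - `| `|f| - `|g| | | <= del + e + e.
  move: uf vg; move: `|f| `|g| => p q.
  rewrite !ler_norml => /andP[? ?] /andP[? ?].
  case: H => ?; first by left; lra.
    by right; split_norms; lra.
  by right; split_norms; lra.
- have [f0|f0] := lerP 0 f; have [g0|g0] := lerP 0 g;
    move: du; rewrite ?(ger0_norm f0) ?(ltr0_norm f0) ?(ger0_norm g0)
      ?(ltr0_norm g0) => du.
  + by right; rewrite (ger0_norm (addr_ge0 f0 g0)).
  + by left; rewrite (_ : `|f - g| = f - g)// ger0_norm; lra.
  + by left; rewrite (_ : `|f - g| = - f + g)// ltr0_norm; lra.
  + by right; rewrite (_ : `|f + g| = - f - g)// ltr0_norm; lra.
- have [f0|f0] := lerP 0 f; have [g0|g0] := lerP 0 g;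
    move: du; rewrite ?(ger0_norm f0) ?(ltr0_norm f0) ?(ger0_norm g0)
      ?(ltr0_norm g0) ?opprK => du.
  + by left.
  + by right.
  + by right; rewrite (_ : `|f + g| = `|- f - g|)// -normrN opprD.
  + by left; rewrite (_ : `|f - g| = `|- f + g|)// -normrN opprB addrC.
Qed.

(** Seen from the base point 0, [d] is close to |f - g| or |f + g|; seen from [a], to |f - g| or |f
    + g - 2a|. If |f - g| is ruled out, then |f + g| and |f + g - 2a| differ by at most 4 del < 2a,
    which forces f + g, and so [d], to be near [a]. This second case is that of Menger's
    pseudolinear quadruples. *)
Lemma pseudolinear_alternative a f g d del : del + del < a ->
  `|d - `|f - g| | <= del \/ `|d - `|f + g| | <= del ->
  `|d - `|(f - a) - (g - a)| | <= 3 * del \/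
  `|d - `|(f - a) + (g - a)| | <= 3 * del ->
  `|d - `|f - g| | <= 3 * del \/
  (`|d - a| <= 3 * del /\ `|f + g - a| <= 2 * del).
Proof.
move=> ad; have -> : (f - a) - (g - a) = f - g by lra.
move=> H1 H2; case: H2 => H2; first by left.
case: H1 => H1; first by left; move: H1; rewrite !ler_norml; lra.
right; split; move: H1 H2; rewrite !ler_norml; split_norms; lra.
Qed.

(** Assume (x, y) falls in the second alternative, so that f + g and [dxy] are near [a]. If exactly
    one pair with z does too, say (y, z), then g + h is near [a], so f is near h and [dxz] is small,
    against the separation. If both do, all three distances are near [a], against the small
    excess. *)
Lemma no_pseudolinear a f g h (dxy dxz dyz rho : R) del : 0 <= del -> 0 < rho ->
  30 * del <= rho -> rho <= a -> rho <= `|h| -> rho <= `|h - a| + del ->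
  rho <= dxz -> rho <= dyz ->
  dxy <= dxz + dyz -> dxz <= dxy + dyz -> dyz <= dxy + dxz ->
  tri_excess dxz dyz dxy <= del ->
  `|dxy - `|f - g| | <= 3 * del \/
  (`|dxy - a| <= 3 * del /\ `|f + g - a| <= 2 * del) ->
  `|dxz - `|f - h| | <= 3 * del \/
  (`|dxz - a| <= 3 * del /\ `|f + h - a| <= 2 * del) ->
  `|dyz - `|g - h| | <= 3 * del \/
  (`|dyz - a| <= 3 * del /\ `|g + h - a| <= 2 * del) ->
  `|dxy - `|f - g| | <= 20 * del.
Proof.
move=> del0 rho0 rdel ra rh rha rxz ryz t1 t2 t3 /tri_excess_le H Hxy Hxz Hyz.
case: Hxy => [|[Hxy Sxy]]; first by rewrite !ler_norml; lra.
case: Hxz => [Hxz|[Hxz Sxz]]; case: Hyz => [Hyz|[Hyz Syz]].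
(* Both pairs with z are linear here. Inserting |f - h|, |g - h| and f + g for the three distances,
   each choice of the longest side places one of h, h - a, f, g near 0. The first two contradict the
   separation of z from the base points; in the last two |f - g| is close to |f + g|, hence to
   [dxy]. *)
- have key : [\/ `|h| <= 8 * del, `|h - a| <= 8 * del,
      `|f| <= 6 * del | `|g| <= 6 * del].
    move: Hxz Hyz Hxy Sxy => {rh rha}.
    rewrite !ler_norml => Hxz Hyz /andP[? ?] /andP[? ?].
    have [fh|fh] := lerP 0 (f - h); have [gh|gh] := lerP 0 (g - h);
      move: Hxz Hyz; rewrite ?(ger0_norm fh) ?(ltr0_norm fh) ?(ger0_norm gh)
        ?(ltr0_norm gh) => /andP[? ?] /andP[? ?]; case: H => ?.
    + by apply: Or41; lra.
    + by apply: Or44; lra.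
    + by apply: Or43; lra.
    + by apply: Or44; lra.
    + by apply: Or41; lra.
    + by apply: Or42; lra.
    + by apply: Or43; lra.
    + by apply: Or42; lra.
    + by apply: Or41; lra.
    + by apply: Or42; lra.
    + by apply: Or43; lra.
    + by apply: Or44; lra.
  case: key => [k|k|k|k]; try lra.
    move: Hxy Sxy k; rewrite !ler_norml => {Hxz Hyz rh rha t1 t2 t3 H}.
    by split_norms; lra.
  move: Hxy Sxy k; rewrite !ler_norml => {Hxz Hyz rh rha t1 t2 t3 H}.
  by split_norms; lra.
- have fh : `|f - h| <= 4 * del.
    by move: Sxy Syz; rewrite !ler_norml => {Hxy Hxz Hyz rh rha}; lra.
  by exfalso; move: Hxz; rewrite ler_norml; lra.
- have gh : `|g - h| <= 4 * del.
    by move: Sxy Sxz; rewrite !ler_norml => {Hxy Hxz Hyz rh rha}; lra.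
  by exfalso; move: Hyz; rewrite ler_norml; lra.
- exfalso; move: Hxz Hyz Hxy; rewrite !ler_norml; case: H => H; lra.
Qed.

End four_points.

(** * The excess of triples and the error of the axis coordinate *)

Section triangular_excess.
Context (R : realType) (X : pmetricType R).
Implicit Types x y z : X.

Local Notation d := (@mdist R X).

Lemma excessE x1 x2 x3 :
  excess x1 x2 x3 = tri_excess (d x1 x2) (d x2 x3) (d x1 x3).
Proof.
have sym := @metric_sym R X.
rewrite /excess; apply/eqP; rewrite eq_le; apply/andP; split.
  rewrite /tri_excess !le_min; apply/and3P; split.
  - apply: (le_trans (@bigmin_le_cond _ R 'S_3 _ 1%g xpredT _ _)) => //.
    by rewrite !perm1 !(tnth_nth x1).
  - apply: (le_trans (@bigmin_le_cond _ R 'S_3 _ (tperm 1 2) xpredT _ _)) => //.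
    rewrite tpermL tpermR tpermD// !(tnth_nth x1) /=; rewrite (sym x3 x2); lra.
  - apply: (le_trans (@bigmin_le_cond _ R 'S_3 _ (tperm 0 1) xpredT _ _)) => //.
    rewrite tpermL tpermR tpermD// !(tnth_nth x1) /= (sym x2 x1); lra.
apply: le_bigmin => [|s _].
  rewrite /tri_excess !perm1 /= !ge_min; apply/orP; left.
  by rewrite !(tnth_nth x1).
have s01 : s 0 != s 1 by rewrite (inj_eq perm_inj).
have s12 : s 1 != s 2 by rewrite (inj_eq perm_inj).
have s02 : s 0 != s 2 by rewrite (inj_eq perm_inj).
(* Only the distinctness of the three indices is kept, which leaves six cases to compute. *)
move: (s 0) (s 1) (s 2) s01 s12 s02.
move=> [[|[|[|//]]] ?] [[|[|[|//]]] ?] [[|[|[|//]]] ?] //= _ _ _;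
  rewrite !(tnth_nth x1) /= /tri_excess;
  rewrite ?(sym x3 x2) ?(sym x3 x1) ?(sym x2 x1) !ge_min; apply/orP;
  first [by left; lra|by right; apply/orP; left; lra|by right; apply/orP; right; lra].
Qed.

Lemma excess_ge0 x1 x2 x3 : 0 <= excess x1 x2 x3.
Proof.
have sym := @metric_sym R X; have tri := @metric_triangle R X.
have := tri x1 x3 x2; have := tri x2 x1 x3; have := tri x1 x2 x3.
rewrite excessE /tri_excess !le_min !subr_ge0 (sym x3 x2) (sym x2 x1) => *.
by apply/and3P; split; lra.
Qed.

(** Each term under the minimum satisfies this bound. It provides the measurability and
    integrability of the excess and of its iterated integrals. *)
Lemma excess_lipschitz x1 x2 x3 y1 y2 y3 :
  excess x1 x2 x3 <= excess y1 y2 y3 + 2 * (d x1 y1 + d x2 y2 + d x3 y3).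
Proof.
have sym := @metric_sym R X; have tri := @metric_triangle R X.
have D x x' y y' : `|d x x' - d y y'| <= d x y + d x' y'.
  rewrite ler_norml; have := tri x y x'; have := tri y y' x'; have := tri y x y'.
  have := tri x x' y'; rewrite (sym y x) (sym y' x'); lra.
move: (D x1 x2 y1 y2) (D x2 x3 y2 y3) (D x1 x3 y1 y3).
rewrite !ler_norml => /andP[? ?] /andP[? ?] /andP[? ?].
rewrite !excessE -lerBlDr {2}/tri_excess !le_min !lerBlDr.
apply/and3P; split; rewrite /tri_excess !ge_min; apply/orP.
- by left; lra.
- by right; apply/orP; left; lra.
- by right; apply/orP; right; lra.
Qed.

Definition axis_coord x0 x1 x : R := signed_coord (d x0 x1) (d x0 x) (d x x1).

(* Up to a constant factor, the pairwise embedding error is controlled by the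
   ten triples among x, y, the two base points and a fifth point z; without z,
   the four points could form a cycle x0, x, x1, y whose opposite sides are
   equal and whose diagonals are geodesic, which has vanishing excesses and
   yet does not embed in the line. *)
Definition excess10 x0 x1 x y z : R :=
  excess x0 x1 x + excess x0 x1 y + excess x0 x1 z + excess x0 x y
  + excess x0 x z + excess x0 y z + excess x1 x y + excess x1 x z
  + excess x1 y z + excess x y z.

Lemma axis_coord_error x0 x1 x y z (rho L : R) : 0 < rho ->
  rho <= d x0 x1 -> rho <= d x0 z -> rho <= d z x1 -> rho <= d x z ->
  rho <= d y z -> d x0 x1 <= L -> d x y <= L -> d x0 x <= L -> d x0 y <= L ->
  `|d x y - `|axis_coord x0 x1 x - axis_coord x0 x1 y| |
    <= 60 * L / rho * excess10 x0 x1 x y z.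
Proof.
have sym := @metric_sym R X; have tri := @metric_triangle R X.
have d0 := @mdist_ge0 R X.
have e0 := excess_ge0.
move=> rho0 ra rz0 rz1 rxz ryz La Lxy Lx Ly.
set f := axis_coord x0 x1 x; set g := axis_coord x0 x1 y.
set h := axis_coord x0 x1 z; set del := excess10 x0 x1 x y z.
have del0 : 0 <= del by rewrite /del /excess10 !addr_ge0.
have rL : rho <= L by exact: le_trans La.
have nf u : `|axis_coord x0 x1 u| = d x0 u by rewrite norm_signed_coord.
(* For large excess the trivial bound 2 L on the error suffices, and 2 * 30 gives the constant 60;
   for small excess the error is at most 20 del, and [rho <= L]. *)
have [big|small] := ltP rho (30 * del).
  have H : `|d x y - `|f - g| | <= 2 * L.
    have fg : `|f - g| <= 2 * L.
      by rewrite (le_trans (ler_normB _ _))// !nf; lra.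
    by rewrite ler_norml; have := normr_ge0 (f - g); have := d0 x y; lra.
  apply: (le_trans H); rewrite mulrAC ler_pdivlMr//; nra.
apply: (@le_trans _ _ (20 * del)); last first.
  rewrite mulrAC ler_pdivlMr//; nra.
have ax u : excess x0 x1 u <= del ->
    `|d u x1 - `|axis_coord x0 x1 u - d x0 x1| | <= del.
  rewrite excessE (sym x1 u) => H; apply: signed_coord_dist => //.
  - by have := tri x0 x1 u; rewrite (sym u x1).
  - by have := tri x1 x0 u; rewrite (sym u x1) (sym x1 x0).
  - by rewrite tri_excessC.
have pair u w : excess x0 x1 u <= del -> excess x0 x1 w <= del ->
    excess x0 u w <= del -> excess x1 u w <= del ->
    let f := axis_coord x0 x1 u in let g := axis_coord x0 x1 w in
    `|d u w - `|f - g| | <= 3 * del \/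
    (`|d u w - d x0 x1| <= 3 * del /\ `|f + g - d x0 x1| <= 2 * del).
  (* The absolute coordinates are exactly the distances to [x0], while those shifted by d(x0, x1)
     give the distances to [x1] up to [del]. Hence the errors [del] and [3 * del]. *)
  move=> /ax Hu /ax Hw H0 H1; apply: pseudolinear_alternative.
  - lra.
  - have /= := @tri_excess_coord _ (d x0 u) (d x0 w) (axis_coord x0 x1 u)
      (axis_coord x0 x1 w) (d u w) del 0.
    rewrite !addr0 !nf !subrr normr0; apply => //.
    + by rewrite (sym x0 u) tri.
    + by rewrite addrC (sym u w) tri.
    + by rewrite addrC tri.
    + by rewrite tri_excessC -excessE.
  - have -> : 3 * del = del + del + del by lra.
    apply: (tri_excess_coord Hu Hw).
    + by rewrite (sym w x1) tri.
    + by rewrite tri.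
    + by rewrite (sym u w) tri.
    + by rewrite (sym u x1) (sym w x1) tri_excessC -excessE.
have ? := e0 x0 x1 x; have ? := e0 x0 x1 y; have ? := e0 x0 x1 z.
have ? := e0 x0 x y; have ? := e0 x0 x z; have ? := e0 x0 y z.
have ? := e0 x1 x y; have ? := e0 x1 x z; have ? := e0 x1 y z.
have ? := e0 x y z.
apply: (@no_pseudolinear _ (d x0 x1) f g h (d x y) (d x z) (d y z) rho del) => //.
- by rewrite nf.
- have : `|d z x1 - `|h - d x0 x1| | <= del.
    by apply: ax; rewrite /del /excess10; lra.
  by rewrite ler_norml; lra.
- by rewrite (sym y z) tri.
- by rewrite (sym x y) tri.
- have <- : excess x y z = tri_excess (d x z) (d y z) (d x y).
    by rewrite excessE tri_excessC; apply: tri_excess_rot.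
  by rewrite /del /excess10; lra.
- by apply: pair; rewrite /del /excess10; lra.
- by apply: pair; rewrite /del /excess10; lra.
- by apply: pair; rewrite /del /excess10; lra.
Qed.

End triangular_excess.

(** * Lower integrals and Lipschitz functions *)

(* The integral of a nonnegative nonmeasurable function is a lower integral, so
   the measurability of [x |-> \int_S |d(x,y) - N (f x - f y)| dy] is not needed. *)
Section lower_integral.
Local Open Scope ereal_scope.
Context d (T : measurableType d) (R : realType).
Variable mu : {measure set T -> \bar R}.
Implicit Types (D : set T) (f g : T -> \bar R).

Import HBNNSimple.

Lemma lower_integral_mono D f g : (forall x, D x -> 0 <= f x) ->
  (forall x, D x -> f x <= g x) ->
  \int[mu]_(x in D) f x <= \int[mu]_(x in D) g x.
Proof.
move=> f0 fg; rewrite !ge0_integralE//; last first.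
  by move=> x Dx; rewrite (le_trans (f0 x Dx))// fg.
apply: ge_ereal_sup => _ [h hf <-]; apply: ereal_sup_ubound.
exists h => // x; apply: (le_trans (hf x)); rewrite /patch.
by case: ifPn => // /set_mem /fg.
Qed.

(** The lower integral is a supremum over simple functions below [f], extended by 0 outside [D]; it
    is enough to test those that lie below [f] on [D]. *)
Lemma lower_integral_le D f M : measurable D -> (forall x, D x -> 0 <= f x) ->
  (forall h : {nnsfun T >-> R}, (forall x, D x -> (h x)%:E <= f x) ->
    \int[mu]_(x in D) (h x)%:E <= M) ->
  \int[mu]_(x in D) f x <= M.
Proof.
move=> mD f0 fM; rewrite ge0_integralE//; apply: ge_ereal_sup => _ [h hf <-].
have hD x : D x -> (h x)%:E <= f x.
  by move=> Dx; apply: (le_trans (hf x)); rewrite patchE mem_set.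
apply: le_trans (fM h hD); rewrite -integralT_nnsfun [leRHS]integral_mkcond.
apply: lower_integral_mono => // x _; first by rewrite lee_fin.
rewrite patchE; case: ifPn => // xD.
by have := hf x; rewrite patchE (negbTE xD).
Qed.

(** Lower integrals are superadditive in general; the measurability of [g] gives the reverse
    inequality. *)
Lemma lower_integralD_le D f g : measurable D ->
  (forall x, D x -> 0 <= f x) -> (forall x, D x -> 0 <= g x) ->
  measurable_fun D g ->
  \int[mu]_(x in D) (f x + g x) <= \int[mu]_(x in D) f x + \int[mu]_(x in D) g x.
Proof.
move=> mD f0 g0 mg; apply: lower_integral_le => // [x Dx|h hfg].
  by rewrite adde_ge0 ?f0 ?g0.
(* The excess of the simple function over [g] is measurable, lies below [f], and together with [g]
   dominates [h]. *)
pose k x := maxe 0 ((h x)%:E - g x).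
have k0 x : 0 <= k x by rewrite /k le_max lexx.
have mk : measurable_fun D k.
  apply: measurable_maxe; first exact: measurable_cst.
  apply: emeasurable_funB => //.
  by apply/measurable_EFinP; exact: measurable_funP.
apply: (@le_trans _ _ (\int[mu]_(x in D) (k x + g x))).
  apply: lower_integral_mono => [x _|x Dx]; first by rewrite lee_fin.
  have := g0 x Dx; rewrite /k; case: (g x) => [r||] //= r0; last first.
    by rewrite addey// leey.
  rewrite -leeBlDr// le_max; apply/orP; right; exact: lexx.
rewrite ge0_integralD//; apply: leeD => //.
apply: lower_integral_mono => // x Dx.
rewrite /k ge_max f0//=; have := hfg x Dx; have := g0 x Dx; have := f0 x Dx.
case: (g x) => [r||] // *; last by rewrite addeNy leNye.
by rewrite leeBlDr.
Qed.

Lemma lower_integralZl_le D f (c : R) : (0 <= c)%R -> measurable D ->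
  (forall x, D x -> 0 <= f x) ->
  \int[mu]_(x in D) (c%:E * f x) <= c%:E * \int[mu]_(x in D) f x.
Proof.
move=> c0 mD f0; have [->|cn0] := eqVneq c 0%R.
  by rewrite mul0e integral0_eq// => x _; rewrite mul0e.
have cp : (0 < c)%R by rewrite lt_neqAle eq_sym cn0.
apply: lower_integral_le => // [x Dx|h hf].
  by rewrite mule_ge0 ?f0// lee_fin.
rewrite -lee_pdivrMl// -ge0_integralZl_EFin//; last 3 first.
- by move=> x _; rewrite lee_fin.
- by apply/measurable_EFinP; exact: measurable_funP.
- by rewrite invr_ge0.
apply: lower_integral_mono => x Dx; first by rewrite -EFinM lee_fin mulr_ge0// invr_ge0.
by rewrite lee_pdivrMl// hf.
Qed.

End lower_integral.

(** * Lipschitz functions and their Borel measurability *)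

Section lipschitz_functions.
Context (R : realType) (X : pmetricType R).
Implicit Types (K : R) (g : X -> R).

Definition lipschitz_fun g :=
  exists2 K, 0 <= K & forall x y, g x <= g y + K * mdist x y.

Lemma open_mdist_gt (g : X -> R) (a K : R) : 0 <= K ->
  (forall x y, g x <= g y + K * mdist x y) -> open [set x | a < g x].
Proof.
move=> K0 gK; have K1 : 0 < K + 1 by lra.
rewrite openE => x; rewrite /= -subr_gt0 => ax.
(* Dividing by [K + 1] covers the case [K = 0]. *)
rewrite /interior -nbhs_ballE; exists ((g x - a) / (K + 1)) => /=.
  exact: divr_gt0.
move=> y; rewrite ballEmdist /= ltr_pdivlMr// => H.
have := gK x y; have := mdist_ge0 x y; nra.
Qed.

Lemma lipschitz_measurable g : lipschitz_fun g ->
  measurable_fun setT (g : borel X -> R).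
Proof.
move=> [K K0 gK].
apply: (measurability _ (RGenOInfty.measurableE R)) => //.
move=> /= _ [_ [a ->] <-]; rewrite setTI.
apply: sub_sigma_algebra.
rewrite (_ : _ @^-1` _ = [set x | a < g x]).
  exact: open_mdist_gt K0 gK.
by apply/seteqP; split => x /=; rewrite in_itv /= andbT.
Qed.

Lemma lipschitz_cst (c : R) : lipschitz_fun (fun=> c).
Proof. by exists 0 => // x y; rewrite mul0r addr0. Qed.

Lemma lipschitzD g h : lipschitz_fun g -> lipschitz_fun h ->
  lipschitz_fun (fun x => g x + h x).
Proof.
move=> [K K0 gK] [L L0 hL]; exists (K + L); first exact: addr_ge0.
by move=> x y; have := gK x y; have := hL x y; nra.
Qed.

Lemma lipschitzZ (c : R) g :
  0 <= c -> lipschitz_fun g -> lipschitz_fun (fun x => c * g x).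
Proof.
move=> c0 [K K0 gK]; exists (c * K); first exact: mulr_ge0.
by move=> x y; have := gK x y; nra.
Qed.

Lemma lipschitz_mdist x : lipschitz_fun (mdist x).
Proof.
exists 1 => // y z; rewrite mul1r (metric_sym y z); exact: metric_triangle.
Qed.

End lipschitz_functions.

(** * Lower bound for iota *)

Section kappa_le_iota.
Context (R : realType) (X : pmetricType R).

(** Homogeneity makes every norm on the line a multiple of the absolute value; the factor is
    nonnegative because 0 = N(1 - 1) <= 2 N(1). *)
Lemma is_normE (N : R -> R) : is_norm N -> 0 <= N 1 /\ forall t, N t = `|t| * N 1.
Proof.
move=> [_ Nh Ns]; have Nt t : N t = `|t| * N 1 by rewrite -{1}(mulr1 t) Nh.
split => //; have := Ns 1 (-1); rewrite subrr (Nt 0) normr0 mul0r (Nt (-1)).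
by rewrite normrN1 mul1r; lra.
Qed.

Lemma tri_excess_le_errors (a u v p q r : R) :
  tri_excess a u v <= `|a - `|p - q| | + `|u - `|q - r| | + `|v - `|p - r| |.
Proof.
have D (s t : R) : s - t <= `|s - t| /\ t - s <= `|s - t|.
  by split; rewrite ?ler_norm// distrC ler_norm.
have [A1 A2] := D a `|p - q|; have [B1 B2] := D u `|q - r|.
have [C1 C2] := D v `|p - r|.
move: A1 A2 B1 B2 C1 C2.
set e1 := `|a - _|; set e2 := `|u - _|; set e3 := `|v - _|.
rewrite /tri_excess !ge_min => A1 A2 B1 B2 C1 C2.
have [H|[H|H]] : `|p - r| = `|p - q| + `|q - r| \/
    (`|p - q| = `|q - r| + `|p - r| \/ `|q - r| = `|p - r| + `|p - q|).
  split_norms; first [by left; lra|by right; left; lra|by right; right; lra].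
- by apply/orP; left; lra.
- by apply/orP; right; apply/orP; left; lra.
- by apply/orP; right; apply/orP; right; lra.
Qed.

Lemma excess_le_errors (N : R -> R) (f : X -> R) x1 x2 x3 : is_norm N ->
  excess x1 x2 x3 <= `|mdist x1 x2 - N (f x1 - f x2)|
    + `|mdist x2 x3 - N (f x2 - f x3)| + `|mdist x1 x3 - N (f x1 - f x3)|.
Proof.
move=> /is_normE[c0 NE]; rewrite excessE.
have E a b : N (f a - f b) = `|N 1 * f a - N 1 * f b|.
  by rewrite NE -mulrBr normrM (ger0_norm c0) mulrC.
by rewrite !E tri_excess_le_errors.
Qed.

Local Open Scope ereal_scope.

(** Each of the three errors involves two of the three variables, and the remaining one integrates
    to a factor mu(S). This gives 3 mu(S) times the double integral, against the normalisation
    mu(S)^-3. *)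
Lemma kappa_le_embedding (S : set (borel X)) (N : R -> R) (f : borel X -> R) :
  measurable S -> 0 < hausdorff1 S -> hausdorff1 S < +oo ->
  is_norm N -> measurable_fun S f ->
  (3^-1)%:E * kappa S <= ((fine (hausdorff1 S)) ^+ 2)^-1%:E *
    \int[@hausdorff1 R X]_(x in S) \int[@hausdorff1 R X]_(y in S)
      (`|mdist (x : X) (y : X) - N (f x - f y)| / diam S)%:E.
Proof.
move=> mS S0 Soo nN mf; have [c0 NE] := is_normE nN.
set mu : {measure set (borel X) -> \bar R} := @hausdorff1 R X.
have D0 : (0 <= (diam S)^-1)%R by rewrite invr_ge0 fine_ge0// ediam_ge0.
pose g (x y : borel X) : R := (`|mdist (x : X) (y : X) - N (f x - f y)| / diam S)%R.
have g0 x y : (0 <= g x y)%R by rewrite mulr_ge0.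
have mg x : measurable_fun S (g x).
  have mNf : measurable_fun S (fun y => N (f x - f y)%R).
    rewrite (_ : (fun y => _) = (fun y => `|f x - f y| * N 1)%R); last first.
      by apply/funext => y; rewrite NE.
    have mfx : measurable_fun S (fun y => f x - f y)%R.
      exact: measurable_funB (measurable_cst _) mf.
    have mnfx : measurable_fun S (fun y => `|f x - f y|)%R.
      exact: measurableT_comp.
    exact: measurable_funM mnfx (measurable_cst (N 1%R)).
  have mdx : measurable_fun S (fun y : borel X => mdist x (y : X)).
    exact: measurable_funTS (lipschitz_measurable (lipschitz_mdist x)).
  have mdN : measurable_fun S (fun y => `|mdist (x : X) (y : X) - N (f x - f y)|)%R.
    by apply: measurableT_comp => //; exact: measurable_funB mdx mNf.
  exact: measurable_funM mdN (measurable_cst (diam S)^-1%R).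
have mgE x : measurable_fun S (fun y => (g x y)%:E) by apply/measurable_EFinP.
pose G x := \int[mu]_(y in S) (g x y)%:E.
have G0 x : 0 <= G x by apply: integral_ge0 => y _; rewrite lee_fin.
pose J := \int[mu]_(x in S) G x.
have J0 : 0 <= J by apply: integral_ge0.
pose m := fine (mu S).
have muS : mu S = m%:E by rewrite fineK// ge0_fin_numE// ltW.
have m0 : (0 < m)%R by rewrite -lte_fin -muS.
have excess_le x1 x2 x3 :
    (excess x1 x2 x3 / diam S <= g x1 x2 + (g x1 x3 + g x2 x3))%R.
  rewrite /g -!mulrDl ler_wpM2r//.
  by have := excess_le_errors f x1 x2 x3 nN; lra.
(* The summand [G x2], whose measurability in [x2] is not established, stands first:
   [lower_integralD_le] asks for measurability of the second summand. *)
have inner x1 x2 : \int[mu]_(x3 in S) (excess x1 x2 x3 / diam S)%:E <=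
    G x2 + (m%:E * (g x1 x2)%:E + G x1).
  apply: (@le_trans _ _ (\int[mu]_(x3 in S)
      ((g x1 x2)%:E + ((g x1 x3)%:E + (g x2 x3)%:E)))).
    apply: lower_integral_mono => x3 _; last by rewrite -!EFinD lee_fin.
    by rewrite lee_fin mulr_ge0// excess_ge0.
  rewrite ge0_integralD//=; last 3 first.
  - by move=> x _; rewrite lee_fin.
  - by move=> x _; rewrite adde_ge0// lee_fin.
  - exact: emeasurable_funD.
  rewrite ge0_integralD//=; last 2 first.
  - by move=> x _; rewrite lee_fin.
  - by move=> x _; rewrite lee_fin.
  rewrite integral_cst// muS -/(G x1) -/(G x2).
  by rewrite addeA addeC muleC.
have middle x1 : \int[mu]_(x2 in S) \int[mu]_(x3 in S)
    (excess x1 x2 x3 / diam S)%:E <= (2 * m)%:E * G x1 + J.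
  apply: (@le_trans _ _ (\int[mu]_(x2 in S)
      (G x2 + (m%:E * (g x1 x2)%:E + G x1)))).
    apply: lower_integral_mono => // x2 _.
    by apply: integral_ge0 => x3 _; rewrite lee_fin mulr_ge0// excess_ge0.
  have mm : measurable_fun S (fun x2 => m%:E * (g x1 x2)%:E + G x1).
    apply: emeasurable_funD; last exact: measurable_cst.
    by apply: measurable_funeM.
  apply: le_trans (lower_integralD_le _ _ _ _ mm) _ => //.
    move=> x _; rewrite adde_ge0// mule_ge0// lee_fin// ltW//.
  rewrite -/J addeC leeD2r// ge0_integralD//=; last 2 first.
  - by move=> x _; rewrite mule_ge0// lee_fin// ltW.
  - exact: measurable_funeM.
  rewrite ge0_integralZl_EFin//; last 2 first.
  - by move=> x _; rewrite lee_fin.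
  - exact: ltW.
  rewrite integral_cst// muS -/(G x1) [G x1 * _]muleC -ge0_muleDl ?lee_fin ?(ltW m0)//.
  by rewrite -EFinD (_ : (m + m = 2 * m)%R)//; lra.
have outer : \int[mu]_(x1 in S) \int[mu]_(x2 in S) \int[mu]_(x3 in S)
    (excess x1 x2 x3 / diam S)%:E <= (3 * m)%:E * J.
  apply: (@le_trans _ _ (\int[mu]_(x1 in S) ((2 * m)%:E * G x1 + J))).
    apply: lower_integral_mono => // x1 _; apply: integral_ge0 => x2 _.
    by apply: integral_ge0 => x3 _; rewrite lee_fin mulr_ge0// excess_ge0.
  have m20 : (0 <= 2 * m)%R by lra.
  have mJ : measurable_fun S (fun=> J) by exact: measurable_cst.
  apply: le_trans (lower_integralD_le _ _ _ _ mJ) _ => //.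
    by move=> x _; rewrite mule_ge0.
  rewrite integral_cst// muS.
  apply: le_trans (leeD2r _ (lower_integralZl_le _ _ _ _)) _ => //.
  rewrite -/J [J * _]muleC -ge0_muleDl ?lee_fin ?(ltW m0)//.
  by rewrite -EFinD (_ : (2 * m + m = 3 * m)%R)//; lra.
rewrite /kappa -/mu -/m.
apply: (@le_trans _ _ ((3^-1)%:E * ((m ^+ 3)^-1%:E * ((3 * m)%:E * J)))).
  rewrite lee_wpmul2l ?lee_fin ?invr_ge0//.
  by rewrite lee_wpmul2l// lee_fin invr_ge0 exprn_ge0// ltW.
rewrite !muleA -!EFinM.
rewrite (_ : (3^-1 * (m ^+ 3)^-1 * (3 * m) = (m ^+ 2)^-1)%R) //.
by field; rewrite gt_eqF.
Qed.

Lemma kappa_le_iota11 (S : set (borel X)) :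
  measurable S -> 0 < hausdorff1 S -> hausdorff1 S < +oo ->
  (3^-1)%:E * kappa S <= iota11 S.
Proof.
move=> mS S0 Soo; apply: le_ereal_inf_tmp => _ [N nN <-].
by apply: le_ereal_inf_tmp => _ [f mf <-]; exact: kappa_le_embedding.
Qed.

End kappa_le_iota.

(** * Upper bound for iota *)

Section bounded_set_integrals.
Context (R : realType) (X : pmetricType R).
Variable mu : {measure set (borel X) -> \bar R}.
Variables (T : set (borel X)) (L : R).
Hypothesis mT : measurable T.
Hypothesis Tfin : (mu T < +oo)%E.
Hypothesis TL : forall x y : X, T x -> T y -> mdist x y <= L.

Local Notation m := (fine (mu T)).
Local Notation I g := (\int[mu]_(x in T) (g x))%R.

Lemma fine_measureK : mu T = m%:E.
Proof. by rewrite fineK// ge0_fin_numE. Qed.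

Lemma fine_measure_ge0 : 0 <= m. Proof. exact: fine_ge0. Qed.

Lemma lipschitz_integrable (g : X -> R) : lipschitz_fun g ->
  mu.-integrable T (EFin \o (g : borel X -> R)).
Proof.
move=> lg; apply: measurable_bounded_integrable => //.
  exact: measurable_funTS (lipschitz_measurable lg).
case: lg => K K0 gK.
have [[t Tt]|T0] := pselect (exists t, T t); last first.
  exists 0; split; first exact: real0.
  by move=> M _ x Tx; case: T0; exists x.
exists (`|g t| + K * L); split; first exact: num_real.
move=> M HM x Tx; apply: (le_trans _ (ltW HM)).
have := gK x t; have := gK t x; rewrite (metric_sym t x).
have : K * mdist x t <= K * L by rewrite ler_wpM2l// TL.
rewrite /= ler_norml; have := ler_norm (g t); have := ler_norm (- g t).
by rewrite normrN; lra.
Qed.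

(* Pairs a Lipschitz function with the value of its integral over T, so that
   integrals of linear combinations can be computed by syntax-directed rules. *)
Definition has_integral (g : X -> R) (v : R) := lipschitz_fun g /\ I g = v.

Lemma has_integral_cst c : has_integral (fun=> c) (m * c).
Proof.
by split; [exact: lipschitz_cst|rewrite Rintegral_cst// mulrC].
Qed.

Lemma has_integralD g h v w : has_integral g v -> has_integral h w ->
  has_integral (fun x => g x + h x) (v + w).
Proof.
move=> [lg <-] [lh <-]; split; first exact: lipschitzD.
by rewrite RintegralD//; exact: lipschitz_integrable.
Qed.

Lemma has_integralZ c g v : 0 <= c -> has_integral g v ->
  has_integral (fun x => c * g x) (c * v).
Proof.
move=> c0 [lg <-]; split; first exact: lipschitzZ.
by rewrite RintegralZl//; exact: lipschitz_integrable.
Qed.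

Lemma has_integral_EFin g v : has_integral g v ->
  (\int[mu]_(x in T) (g x)%:E = v%:E)%E.
Proof.
move=> [lg <-]; rewrite /Rintegral fineK//.
by apply: integrable_fin_num => //; exact: (lipschitz_integrable lg).
Qed.

Lemma le_has_integral g h v w : has_integral g v -> has_integral h w ->
  (forall x, T x -> g x <= h x) -> v <= w.
Proof.
by move=> [lg <-] [lh <-] gh; apply: le_Rintegral => //; exact: lipschitz_integrable.
Qed.

(** Integrating out one variable keeps the Lipschitz property in the other, so iterated integrals
    stay within the functions handled by [has_integral]. *)
Lemma lipschitz_integral (F : X -> X -> R) K : 0 <= K ->
  (forall x x' y, F x y <= F x' y + K * mdist x x') ->
  (forall x, lipschitz_fun (F x)) ->
  forall x x', I (F x) <= I (F x') + K * m * mdist x x'.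
Proof.
move=> K0 FK lF x x'.
have H : has_integral (fun y => F x' y + K * mdist x x')
    (I (F x') + m * (K * mdist x x')).
  by apply: has_integralD; [split|exact: has_integral_cst].
rewrite -mulrA mulrCA; apply: (le_has_integral _ H) => //.
Qed.

(** * Iterated integrals of the excess *)

Definition int_excess x1 x2 := I (fun x3 => excess x1 x2 x3).
Definition int2_excess x1 := I (fun x2 => int_excess x1 x2).
Definition int3_excess := I int2_excess.

Lemma has_integral_excess x1 x2 : has_integral (excess x1 x2) (int_excess x1 x2).
Proof.
split=> //; exists 2 => // x y.
by have := excess_lipschitz x1 x2 x x1 x2 y; rewrite !mdistxx !add0r.
Qed.

Lemma int_excess_lipschitz x1 x2 y1 y2 :
  int_excess x1 x2 <= int_excess y1 y2 + 2 * m * (mdist x1 y1 + mdist x2 y2).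
Proof.
have H1 : int_excess x1 x2 <= int_excess y1 x2 + 2 * m * mdist x1 y1.
  apply: (lipschitz_integral (F := fun x => excess x x2)) => //.
    move=> x x' y; have := excess_lipschitz x x2 y x' x2 y.
    by rewrite !mdistxx !addr0.
  by move=> x; case: (has_integral_excess x x2).
apply: (le_trans H1); rewrite mulrDr addrA addrAC lerD2r.
apply: (lipschitz_integral (F := fun x => excess y1 x)) => //.
  move=> x x' y; have := excess_lipschitz y1 x y y1 x' y.
  by rewrite !mdistxx add0r addr0.
by move=> x; case: (has_integral_excess y1 x).
Qed.

Lemma has_integral_int_excess x1 : has_integral (int_excess x1) (int2_excess x1).
Proof.
split=> //; exists (2 * m); first by rewrite mulr_ge0// fine_measure_ge0.
by move=> x y; have := int_excess_lipschitz x1 x x1 y; rewrite mdistxx add0r.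
Qed.

Lemma has_integral_int2_excess : has_integral int2_excess int3_excess.
Proof.
split=> //; exists (2 * m * m); first by rewrite !mulr_ge0// fine_measure_ge0.
apply: (lipschitz_integral (F := int_excess)) => //.
- by move=> x x' y; have := int_excess_lipschitz x y x' y; rewrite mdistxx addr0.
- by move=> x; case: (has_integral_int_excess x).
Qed.

Lemma int_excess_ge0 x1 x2 : 0 <= int_excess x1 x2.
Proof. by apply: Rintegral_ge0 => x _; exact: excess_ge0. Qed.

Lemma int2_excess_ge0 x1 : 0 <= int2_excess x1.
Proof. by apply: Rintegral_ge0 => x _; exact: int_excess_ge0. Qed.

Lemma int3_excess_ge0 : 0 <= int3_excess.
Proof. by apply: Rintegral_ge0 => x _; exact: int2_excess_ge0. Qed.

Lemma triple_integral_excess (w : R) : 0 <= w ->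
  (\int[mu]_(x1 in T) \int[mu]_(x2 in T) \int[mu]_(x3 in T)
    (excess x1 x2 x3 * w)%:E = (int3_excess * w)%:E)%E.
Proof.
move=> w0.
have H x1 x2 : (\int[mu]_(x3 in T) (excess x1 x2 x3 * w)%:E = (int_excess x1 x2 * w)%:E)%E.
  rewrite mulrC -(has_integral_EFin (has_integralZ w0 (has_integral_excess x1 x2))).
  by apply: eq_integral => x _; rewrite mulrC.
under eq_integral => x1 _ do under eq_integral => x2 _ do rewrite H.
have H1 x1 : (\int[mu]_(x2 in T) (int_excess x1 x2 * w)%:E = (int2_excess x1 * w)%:E)%E.
  rewrite mulrC -(has_integral_EFin (has_integralZ w0 (has_integral_int_excess x1))).
  by apply: eq_integral => x _; rewrite mulrC.
under eq_integral => x1 _ do rewrite H1.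
rewrite mulrC -(has_integral_EFin (has_integralZ w0 has_integral_int2_excess)).
by apply: eq_integral => x _; rewrite mulrC.
Qed.

(** Apart from constants, the rule is selected by the shape of the value, since the integrand is a
    function under a binder. *)
Ltac integrate := repeat match goal with
  | |- has_integral (fun=> ?c) _ => exact: (has_integral_cst c)
  | |- has_integral _ (_ + _) => apply: has_integralD
  | |- has_integral _ (int_excess ?a ?b) => exact: (has_integral_excess a b)
  | |- has_integral _ (int2_excess ?a) => exact: (has_integral_int_excess a)
  | |- has_integral _ int3_excess => exact: has_integral_int2_excess
  | |- has_integral _ (_ * _) => apply: has_integralZ; first exact: fine_measure_ge0
  end.

(** This and the next three definitions integrate [excess10] term by term in [z], [y], [x], [x1]: a
    term free of the variable gains a factor [m]. Each triple lists its points in the order x0, x1,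
    x, y, z, so the variable being integrated is always the last argument left. *)
Definition int_excess10 x0 x1 x y :=
  m * excess x0 x1 x + m * excess x0 x1 y + int_excess x0 x1 + m * excess x0 x y
  + int_excess x0 x + int_excess x0 y + m * excess x1 x y + int_excess x1 x
  + int_excess x1 y + int_excess x y.

Definition int2_excess10 x0 x1 x :=
  m * (m * excess x0 x1 x) + m * int_excess x0 x1 + m * int_excess x0 x1
  + m * int_excess x0 x + m * int_excess x0 x + int2_excess x0
  + m * int_excess x1 x + m * int_excess x1 x + int2_excess x1 + int2_excess x.

Definition int3_excess10 x0 x1 :=
  m * (m * int_excess x0 x1) + m * (m * int_excess x0 x1)
  + m * (m * int_excess x0 x1) + m * int2_excess x0 + m * int2_excess x0
  + m * int2_excess x0 + m * int2_excess x1 + m * int2_excess x1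
  + m * int2_excess x1 + int3_excess.

Definition int4_excess10 x0 :=
  m * (m * int2_excess x0) + m * (m * int2_excess x0) + m * (m * int2_excess x0)
  + m * (m * int2_excess x0) + m * (m * int2_excess x0) + m * (m * int2_excess x0)
  + m * int3_excess + m * int3_excess + m * int3_excess + m * int3_excess.

Lemma has_integral_excess10 x0 x1 x y :
  has_integral (excess10 x0 x1 x y) (int_excess10 x0 x1 x y).
Proof. rewrite /excess10 /int_excess10. integrate. Qed.

Lemma has_integral_int_excess10 x0 x1 x :
  has_integral (int_excess10 x0 x1 x) (int2_excess10 x0 x1 x).
Proof. rewrite /int_excess10 /int2_excess10. integrate. Qed.

Lemma has_integral_int2_excess10 x0 x1 :
  has_integral (int2_excess10 x0 x1) (int3_excess10 x0 x1).
Proof. rewrite /int2_excess10 /int3_excess10. integrate. Qed.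

Lemma has_integral_int3_excess10 x0 : has_integral (int3_excess10 x0) (int4_excess10 x0).
Proof. rewrite /int3_excess10 /int4_excess10. integrate. Qed.

Lemma has_integral_int4_excess10 : has_integral int4_excess10 (10 * m ^+ 2 * int3_excess).
Proof.
pose t := m * (m * int3_excess).
have : has_integral int4_excess10 (t + t + t + t + t + t + t + t + t + t).
  rewrite /int4_excess10 /t; integrate.
by congr has_integral; rewrite /t; ring.
Qed.

Lemma excess10_ge0 (x0 x1 x y z : X) : 0 <= excess10 x0 x1 x y z.
Proof. by rewrite /excess10 !addr_ge0// excess_ge0. Qed.

Lemma int_excess10_ge0 x0 x1 x y : 0 <= int_excess10 x0 x1 x y.
Proof.
rewrite -(has_integral_excess10 x0 x1 x y).2.
by apply: Rintegral_ge0 => z _; exact: excess10_ge0.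
Qed.

Lemma int2_excess10_ge0 x0 x1 x : 0 <= int2_excess10 x0 x1 x.
Proof.
rewrite -(has_integral_int_excess10 x0 x1 x).2.
by apply: Rintegral_ge0 => z _; exact: int_excess10_ge0.
Qed.

Lemma int3_excess10_ge0 x0 x1 : 0 <= int3_excess10 x0 x1.
Proof.
rewrite -(has_integral_int2_excess10 x0 x1).2.
by apply: Rintegral_ge0 => z _; exact: int2_excess10_ge0.
Qed.

Lemma int4_excess10_ge0 x0 : 0 <= int4_excess10 x0.
Proof.
rewrite -(has_integral_int3_excess10 x0).2.
by apply: Rintegral_ge0 => z _; exact: int3_excess10_ge0.
Qed.

Lemma lower_integral_le_has_integral (S : set (borel X)) (f : X -> \bar R) g v :
  measurable S -> S `<=` T -> has_integral g v -> (forall x, T x -> 0 <= g x) ->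
  (forall x, S x -> 0 <= f x <= (g x)%:E)%E -> (\int[mu]_(x in S) f x <= v%:E)%E.
Proof.
move=> mS ST Hg g0 fg.
apply: (@le_trans _ _ (\int[mu]_(x in S) (g x)%:E)%E).
  by apply: lower_integral_mono => x Sx; have /andP[] := fg x Sx.
rewrite -(has_integral_EFin Hg); apply: ge0_subset_integral => //.
by apply/measurable_EFinP; exact: measurable_funTS (lipschitz_measurable Hg.1).
Qed.

(** * Averaging away from small balls *)

Variable rho : R.
Hypothesis small_balls :
  forall p : X, T p -> (mu (T `&` ball p rho) <= (m / 8)%:E)%E.

Lemma measurable_ball (p : X) : measurable (ball p rho : set (borel X)).
Proof.
apply: sub_sigma_algebra.
rewrite (_ : ball p rho = [set x | - rho < - mdist p x]); last first.
  by apply/seteqP; split => x /=; rewrite ballEmdist /= ltrN2.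
apply: (@open_mdist_gt _ _ _ _ 1) => // x y; rewrite mul1r.
by have := metric_triangle p x y; lra.
Qed.

(** The balls of radius [rho] about the points of [s] are removed one at a time, each at a cost of
    at most m / 8. *)
Lemma off_balls (s : seq X) : (forall p, p \in s -> T p) ->
  exists Z : set (borel X), [/\ measurable Z, Z `<=` T,
    (forall p z, p \in s -> Z z -> rho <= mdist p z) &
    (mu T <= mu Z + ((size s)%:R * (m / 8))%:E)%E].
Proof.
elim: s => [_|p s IH sT].
  by exists T; split => //; rewrite mul0r adde0.
have [|Z [mZ ZT Zs ZT']] := IH.
  by move=> q qs; apply: sT; rewrite inE qs orbT.
have mB : measurable (T `&` ball p rho : set (borel X)).
  by apply: measurableI => //; exact: measurable_ball.
exists (Z `\` (T `&` ball p rho)); split.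
- exact: measurableD.
- by move=> x [/ZT].
- move=> q z; rewrite inE => /predU1P[->|qs] [Zz nB]; last exact: Zs.
  rewrite leNgt; apply/negP => pz; apply: nB; split; first exact: ZT.
  by rewrite ballEmdist.
- apply: (le_trans ZT'); rewrite (measureDI mu mZ mB) -addeA leeD2l//.
  have -> : (size (p :: s))%:R * (m / 8) = m / 8 + (size s)%:R * (m / 8).
    by rewrite /= -natr1; lra.
  rewrite EFinD leeD2r//.
  have Tp : T p by apply: sT; rewrite mem_head.
  apply: le_trans (small_balls Tp).
  by apply: le_measure; rewrite ?inE//; exact: measurableI.
Qed.

(** Removing at most four balls leaves at least half of the mass, on which [g] is at least [c]. The
    bound [c] is extended real because it will be a multiple of [iota11], not yet known to be
    finite. *)
Lemma average_off_balls (s : seq X) g v (c : \bar R) : has_integral g v ->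
  (forall x, T x -> 0 <= g x) -> (0 <= c)%E -> (size s <= 4)%N ->
  (forall p, p \in s -> T p) ->
  (forall z, T z -> (forall p, p \in s -> rho <= mdist p z) -> (c <= (g z)%:E)%E) ->
  (c * (m / 2)%:E <= v%:E)%E.
Proof.
move=> Hg g0 c0 s4 sT cg; have [Z [mZ ZT Zs TZ]] := off_balls sT.
have Zm : ((m / 2)%:E <= mu Z)%E.
  have Zfin : mu Z \is a fin_num.
    rewrite ge0_fin_numE//; apply: le_lt_trans Tfin.
    by apply: le_measure; rewrite ?inE.
  have : (size s)%:R <= 4 :> R by rewrite ler_nat.
  move: TZ; rewrite fine_measureK -(fineK Zfin) -EFinD !lee_fin; have := fine_measure_ge0; nra.
apply: (@le_trans _ _ (c * mu Z)%E); first by rewrite lee_wpmul2l.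
rewrite -integral_cst//; apply: (lower_integral_le_has_integral mZ ZT Hg) => //.
by move=> x Zx; rewrite c0 cg//; [exact: ZT|move=> p ps; exact: Zs].
Qed.

Hypothesis m_gt0 : 0 < m.
Hypothesis rho_gt0 : 0 < rho.

(** To be used with [A] the value of [iota11] at [S], [b] = mu(S)^-2 and [w] = 1 / diam(S): each
    pair of base points yields a competitor for the infimum. *)
Lemma axis_embedding_integral (S : set (borel X)) (A : \bar R) (b w : R) :
  measurable S -> S `<=` T -> 0 <= b -> 0 <= w -> (0 <= A)%E ->
  (forall x0 x1, T x0 -> T x1 -> (A <= b%:E * \int[mu]_(x in S) \int[mu]_(y in S)
    (`|mdist (x : X) (y : X) - `|axis_coord x0 x1 x - axis_coord x0 x1 y| | * w)%:E)%E) ->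
  (A <= (b * w * (4800 * L / rho) * int3_excess / m)%:E)%E.
Proof.
move=> mS ST b0 w0 A0 HA.
have mp : 0 <= m / 2 by rewrite divr_ge0// ltW.
have [[t Tt]|T0] := pselect (exists t, T t); last first.
  by have := m_gt0; rewrite (_ : T = set0) ?measure0 ?ltxx//;
    apply/seteqP; split => // x Tx; apply: T0; exists x.
have L0 : 0 <= L by apply: le_trans (TL Tt Tt); exact: mdist_ge0.
pose K := 60 * L / rho.
have K0 : 0 <= K by rewrite /K divr_ge0 ?mulr_ge0// ltW.
(* The factor 2 / m comes from averaging over the admissible z, which carry at least half of the
   mass. *)
pose k := w * (K * (2 / m)).
have k0 : 0 <= k.
  by rewrite /k mulr_ge0// mulr_ge0// divr_ge0// ltW.
have pointwise x0 x1 x y : T x0 -> T x1 -> T x -> T y -> rho <= mdist x0 x1 ->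
    `|mdist x y - `|axis_coord x0 x1 x - axis_coord x0 x1 y| | * w <= k * int_excess10 x0 x1 x y.
  move=> T0 T1 Tx Ty r01.
  have := @average_off_balls [:: x0; x1; x; y] (fun z => K * excess10 x0 x1 x y z)
    (K * int_excess10 x0 x1 x y)
    (`|mdist x y - `|axis_coord x0 x1 x - axis_coord x0 x1 y| |)%:E.
  rewrite -EFinM !lee_fin => H.
  have {}H : `|mdist x y - `|axis_coord x0 x1 x - axis_coord x0 x1 y| | * (m / 2)
      <= K * int_excess10 x0 x1 x y.
    apply: H => //.
    - by apply: has_integralZ => //; exact: has_integral_excess10.
    - by move=> z _; rewrite mulr_ge0// excess10_ge0.
    - by move=> p; rewrite !inE => /or4P[] /eqP ->.
    - move=> z Tz far; rewrite lee_fin; apply: axis_coord_error => //.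
      + by apply: far; rewrite !inE eqxx.
      + by rewrite metric_sym; apply: far; rewrite !inE eqxx orbT.
      + by apply: far; rewrite !inE eqxx !orbT.
      + by apply: far; rewrite !inE eqxx !orbT.
      + exact: TL.
      + exact: TL.
      + exact: TL.
      + exact: TL.
  rewrite /k mulrC -mulrA ler_wpM2l// mulrAC mulrA ler_pdivlMr//.
  by move: H; rewrite mulrA ler_pdivrMr//; lra.
have outer x0 x1 : T x0 -> T x1 -> rho <= mdist x0 x1 ->
    (A <= (b * k * int3_excess10 x0 x1)%:E)%E.
  move=> T0 T1 r01; apply: (le_trans (HA _ _ T0 T1)).
  rewrite -mulrA EFinM lee_wpmul2l ?lee_fin//.
  apply: (@lower_integral_le_has_integral _ _ (fun x => k * int2_excess10 x0 x1 x)) => //.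
  - by apply: has_integralZ => //; exact: has_integral_int2_excess10.
  - by move=> x _; rewrite mulr_ge0// int2_excess10_ge0.
  move=> x Sx; apply/andP; split.
    by apply: integral_ge0 => y _; rewrite lee_fin mulr_ge0.
  apply: (@lower_integral_le_has_integral _ _ (fun y => k * int_excess10 x0 x1 x y)) => //.
  - by apply: has_integralZ => //; exact: has_integral_int_excess10.
  - by move=> y _; rewrite mulr_ge0// int_excess10_ge0.
  by move=> y Sy; rewrite !lee_fin mulr_ge0//= pointwise//; exact: ST.
have bk0 : 0 <= b * k by rewrite mulr_ge0.
(* Now [x1] is averaged over the points at distance at least [rho] from [x0]; after that [x0] is
   unrestricted, hence the empty list in [A2]. *)
have A1 x0 : T x0 -> (A * (m / 2)%:E <= (b * k * int4_excess10 x0)%:E)%E.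
  move=> T0; apply: (@average_off_balls [:: x0] (fun x1 => b * k * int3_excess10 x0 x1)) => //.
  - by apply: has_integralZ => //; exact: has_integral_int3_excess10.
  - by move=> x1 _; rewrite mulr_ge0// int3_excess10_ge0.
  - by move=> p; rewrite inE => /eqP ->.
  - by move=> x1 T1 far; apply: outer => //; apply: far; rewrite inE.
have A2 : (A * (m / 2)%:E * (m / 2)%:E <= (b * k * (10 * m ^+ 2 * int3_excess))%:E)%E.
  apply: (@average_off_balls [::] (fun x0 => b * k * int4_excess10 x0)) => //.
  - by apply: has_integralZ => //; exact: has_integral_int4_excess10.
  - by move=> x1 _; rewrite mulr_ge0// int4_excess10_ge0.
  - by rewrite mule_ge0.
  - by move=> x0 T0 _; exact: A1.
(* For finite [A] the constant is 60 * 2 * 10 * 4 = 4800: the pointwise error, the average over z,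
   the ten triples, and the averages over [x1] and [x0]. The value +oo contradicts [A2]. *)
move: A2 A0; case: A {HA outer A1} => [a||] //.
  rewrite -!EFinM !lee_fin => A2 _.
  have m20 : 0 < m / 2 * (m / 2) by rewrite mulr_gt0// divr_gt0.
  rewrite -(ler_pM2r m20) [leLHS]mulrA; apply: (le_trans A2).
  rewrite le_eqVlt; apply/orP; left; apply/eqP.
  by rewrite /k /K; field; rewrite !gt_eqF.
have m20 : 0 < m / 2 by rewrite divr_gt0.
by rewrite !gt0_mulye ?lte_fin// leye_eq.
Qed.

End bounded_set_integrals.

(** * Comparing [iota11] of a set with [kappa] of a larger one *)

Section iota_le_kappa.
Context (R : realType) (X : pmetricType R).

Lemma is_norm_normr : is_norm (@Num.norm R R).
Proof.
by split => [x /eqP|a x|x y]; [rewrite normr_eq0 => /eqP|rewrite normrM|exact: ler_normD].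
Qed.

Lemma measurable_axis_coord (x0 x1 : X) (S : set (borel X)) :
  measurable_fun S (axis_coord x0 x1 : borel X -> R).
Proof.
apply: measurable_funTS.
have m0 : measurable_fun setT (mdist x0 : borel X -> R).
  exact: lipschitz_measurable (lipschitz_mdist x0).
have m1 : measurable_fun setT ((fun x => mdist x x1) : borel X -> R).
  rewrite (_ : (fun x => _) = mdist x1); last by apply/funext => x; rewrite metric_sym.
  exact: lipschitz_measurable (lipschitz_mdist x1).
apply: measurable_fun_ifT => //.
  apply: measurable_and; first exact: measurable_fun_ler m0 m1.
  exact: measurable_fun_ler (measurable_cst _) m1.
exact: measurable_funN.
Qed.

Local Open Scope ereal_scope.

Lemma kappa_ge0 (S : set X) : 0 <= kappa S.
Proof.
have D0 : (0 <= (diam S)^-1)%R by rewrite invr_ge0 fine_ge0// ediam_ge0.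
rewrite mule_ge0 ?lee_fin ?invr_ge0 ?exprn_ge0 ?fine_ge0//.
apply: integral_ge0 => x _; apply: integral_ge0 => y _; apply: integral_ge0 => z _.
by rewrite lee_fin mulr_ge0// excess_ge0.
Qed.

Lemma iota11_ge0 (S : set X) : 0 <= iota11 S.
Proof.
have D0 : (0 <= (diam S)^-1)%R by rewrite invr_ge0 fine_ge0// ediam_ge0.
apply: le_ereal_inf_tmp => _ [N _ <-]; apply: le_ereal_inf_tmp => _ [f _ <-].
rewrite mule_ge0 ?lee_fin ?invr_ge0 ?exprn_ge0 ?fine_ge0//.
apply: integral_ge0 => x _; apply: integral_ge0 => y _.
by rewrite lee_fin mulr_ge0.
Qed.

Lemma ediam_le (A : set X) (L : R) : (0 <= L)%R ->
  (forall x y, A x -> A y -> mdist x y <= L)%R -> ediam A <= L%:E.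
Proof.
move=> L0 AL; apply: ge_ereal_sup => _ [->|[[x y] [Ax Ay] <-]]; rewrite lee_fin//.
exact: AL.
Qed.

Lemma iota11_le_kappa (S T : set (borel X)) (C c1 c2 D : R) :
  (0 < C)%R -> (0 < c1)%R -> (0 < D)%R ->
  measurable S -> measurable T -> S `<=` T ->
  (forall x y : X, T x -> T y -> mdist x y <= 13 * D)%R ->
  (D <= diam S)%R -> (c1 * D)%:E <= hausdorff1 S -> hausdorff1 T <= (c2 * D)%:E ->
  (forall (p : X) (r : R), T p -> (0 < r)%R -> hausdorff1 (T `&` ball p r) <= (C * r)%:E) ->
  iota11 S <= (4800 * 8 * 13 * 13 * C * c2 / c1 ^+ 2)%:E * kappa T.
Proof.
move=> C0 c10 D0 mS mT ST TD DS c1S Tc2 balls.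
set mu : {measure set (borel X) -> \bar R} := @hausdorff1 R X.
have Tfin : mu T < +oo by apply: (le_lt_trans Tc2); exact: ltry.
have muST : mu S <= mu T by apply: le_measure; rewrite ?inE.
have Sfin : mu S < +oo by exact: le_lt_trans Tfin.
set m := fine (mu T).
have muTE : mu T = m%:E by exact: fine_measureK Tfin.
have muSE : mu S = (fine (mu S))%:E by exact: fine_measureK Sfin.
set n := fine (mu S) in muSE.
have n1 : (c1 * D <= n)%R by rewrite -lee_fin -muSE.
have nm : (n <= m)%R by rewrite -lee_fin -muSE -muTE.
have m2 : (m <= c2 * D)%R by rewrite -lee_fin -muTE.
have n0 : (0 < n)%R by apply: lt_le_trans n1; exact: mulr_gt0.
have m0 : (0 < m)%R by exact: lt_le_trans nm.
have S0 : (0 < diam S)%R by exact: lt_le_trans DS.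
have TL : ediam T <= (13 * D)%:E by apply: ediam_le => //; lra.
have dT : (diam T <= 13 * D)%R.
  rewrite -lee_fin fineK// ge0_fin_numE ?ediam_ge0//.
  by apply: le_lt_trans TL _; exact: ltry.
have diamST : (diam S <= diam T)%R.
  have EST : ediam S <= ediam T.
    apply: ereal_sup_le => _ [->|[[x y] [Sx Sy] <-]]; first by left.
    by right; exists (x, y) => //; split; exact: ST.
  rewrite fine_le// ge0_fin_numE ?ediam_ge0//; last first.
    by apply: le_lt_trans TL _; exact: ltry.
  by apply: le_lt_trans EST _; apply: le_lt_trans TL _; exact: ltry.
have dT0 : (0 < diam T)%R by exact: lt_le_trans diamST.
(* With this radius, upper regularity bounds the mass of a ball by exactly m / 8. *)
have rho0 : (0 < m / (8 * C))%R by rewrite divr_gt0// mulr_gt0.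
have := @axis_embedding_integral R X mu T (13 * D) mT Tfin TD (m / (8 * C)) _ m0 rho0
  S (iota11 S) (n ^+ 2)^-1 (diam S)^-1 mS ST _ _ (iota11_ge0 S) _.
set G := int3_excess _ _ => H.
have kE : kappa T = ((m ^+ 3)^-1 * (G / diam T))%:E.
  rewrite EFinM /kappa -/mu -/m; congr (_ * _).
  apply: (@triple_integral_excess R X mu T (13 * D) mT Tfin TD).
  by rewrite invr_ge0 ltW.
have G_ge0 : (0 <= G)%R by exact: int3_excess_ge0.
apply: le_trans (H _ _ _ _) _.
- move=> p Tp; apply: le_trans (balls p _ Tp rho0) _.
  rewrite lee_fin -/m le_eqVlt; apply/orP; left; apply/eqP; field.
  by rewrite gt_eqF.
- by rewrite invr_ge0 exprn_ge0// ltW.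
- by rewrite invr_ge0 ltW.
- move=> x0 x1 Tx0 Tx1; apply: le_trans (ereal_inf_lbound _) _.
    by exists (@Num.norm R R); [exact: is_norm_normr|reflexivity].
  apply: ereal_inf_lbound; exists (axis_coord x0 x1) => //.
  exact: measurable_axis_coord.
rewrite kE -EFinM lee_fin -/m.
set a := diam S in DS S0 *; set b := diam T in dT dT0 *.
(* After factoring out [P] and the numerical constant, D / (n^2 a) <= 13 c2 / (c1^2 m b) remains,
   which follows from n >= c1 D, a >= D, m <= c2 D and b <= 13 D. In the constant, 8 comes from the
   radius and the other 13 from the bound on distances in [T]. *)
pose P := (C * G / m ^+ 2)%R.
have P0 : (0 <= P)%R.
  by apply: divr_ge0; [apply: mulr_ge0 => //; exact: ltW|rewrite exprn_ge0// ltW].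
have -> : ((n ^+ 2)^-1 * a^-1 * (4800 * (13 * D) / (m / (8 * C))) * G / m =
    P * (D / (n ^+ 2 * a)) * (4800 * 13 * 8))%R.
  by rewrite /P; field; rewrite !gt_eqF.
have -> : (4800 * 8 * 13 * 13 * C * c2 / c1 ^+ 2 * ((m ^+ 3)^-1 * (G / b)) =
    P * (13 * c2 / (c1 ^+ 2 * m * b)) * (4800 * 13 * 8))%R.
  by rewrite /P; field; rewrite !gt_eqF.
apply: ler_wpM2r; first lra.
apply: ler_wpM2l; first exact: P0.
rewrite ler_pdivrMr ?mulr_gt0 ?exprn_gt0//.
rewrite mulrAC ler_pdivlMr ?mulr_gt0 ?exprn_gt0//.
have c20 : (0 < c2)%R by rewrite -(pmulr_lgt0 _ D0); exact: lt_le_trans m2.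
have h1 : (m * b <= c2 * D * (13 * D))%R by apply: ler_pM => //; exact: ltW.
have h2 : (c1 ^+ 2 * D ^+ 2 <= n ^+ 2)%R.
  by rewrite -exprMn lerXn2r// nnegrE ltW// mulr_gt0.
have h3 : (c1 ^+ 2 * D ^+ 2 * D <= n ^+ 2 * a)%R.
  by apply: ler_pM => //; [rewrite mulr_ge0// exprn_ge0// ltW|exact: ltW].
have c1D : (0 <= c1 ^+ 2 * D)%R by rewrite mulr_ge0 ?exprn_ge0// ltW.
have h4 := ler_wpM2l c1D h1.
have h5 := ler_wpM2l (ltW c20) h3.
lra.
Qed.

End iota_le_kappa.

(** * Regular sets, cubes and their dilates *)

Section regular_sets.
Context (R : realType) (X : pmetricType R).
Implicit Types (E Q : set X) (x : X).

Lemma open_infdist_gt Q (a : R) : open [set x | (a%:E < infdist x Q)%E].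
Proof.
rewrite openE => x /= ax.
have [e e0 ae] : exists2 e, 0 < e & ((a + e)%:E <= infdist x Q)%E.
  move: ax; case: (infdist x Q) => [b||] //.
    rewrite lte_fin => ab; exists (b - a); first by rewrite subr_gt0.
    by rewrite lee_fin; lra.
  (* The distance to the empty set is +oo. *)
  by move=> _; exists 1 => //; rewrite leey.
rewrite /interior -nbhs_ballE; exists (e / 2) => /=; first exact: divr_gt0.
move=> y; rewrite ballEmdist /= => xy.
apply: (@lt_le_trans _ _ (a + e / 2)%:E); first by rewrite lte_fin; lra.
apply: le_ereal_inf_tmp => _ [q Qq <-]; rewrite lee_fin.
have : a + e <= mdist x q.
  by rewrite -lee_fin (le_trans ae)//; apply: ereal_inf_lbound; exists q.
by have := metric_triangle x y q; lra.
Qed.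

Lemma measurable_dilate E K Q :
  closed E -> measurable (dilate E K Q : set (borel X)).
Proof.
move=> cE.
have -> : dilate E K Q = ~` (~` E `|` [set x | (((K - 1) * diam Q)%:E < infdist x Q)%E]).
  apply/seteqP; split => x /=.
    by move=> [Ex xQ] [//|]; rewrite ltNge xQ.
  move=> /not_orP[/contrapT Ex /negP]; rewrite -leNgt => xQ; split => //.
apply: measurableC; apply: measurableU; apply: sub_sigma_algebra.
  exact: closed_openC.
exact: open_infdist_gt.
Qed.

Lemma diam_ge0 Q : 0 <= diam Q. Proof. by rewrite fine_ge0// ediam_ge0. Qed.

Lemma sub_dilate E K Q : 1 <= K -> Q `<=` E -> Q `<=` dilate E K Q.
Proof.
move=> K1 QE x Qx; split; first exact: QE.
apply: (@le_trans _ _ 0%E).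
  by apply: ereal_inf_lbound; exists x => //; rewrite mdistxx.
by rewrite lee_fin mulr_ge0 ?subr_ge0// diam_ge0.
Qed.

Lemma dilateS E K K' Q : K <= K' -> dilate E K Q `<=` dilate E K' Q.
Proof.
move=> KK' x [Ex xQ]; split=> //; apply: (le_trans xQ).
by rewrite lee_fin ler_wpM2r ?diam_ge0// lerB.
Qed.

(** Pass through almost nearest points of [Q]: the three legs contribute K - 1, 1 and K - 1
    diameters. For [K = 7] this is the constant 13. *)
Lemma mdist_dilate E K Q x y : ediam Q \is a fin_num ->
  dilate E K Q x -> dilate E K Q y -> mdist x y <= (2 * K - 1) * diam Q.
Proof.
move=> Qfin [_ xQ] [_ yQ]; apply/ler_addgt0Pr => e e0.
have near z : (infdist z Q <= ((K - 1) * diam Q)%:E)%E ->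
    exists2 q, Q q & mdist z q < (K - 1) * diam Q + e / 2.
  move=> zQ; have : (infdist z Q < ((K - 1) * diam Q + e / 2)%:E)%E.
    by apply: (le_lt_trans zQ); rewrite lte_fin ltrDl divr_gt0.
  move=> /ereal_inf_lt[_ [q Qq <-]]; rewrite lte_fin => zq.
  by exists q.
have [p Qp xp] := near _ xQ; have [q Qq yq] := near _ yQ.
have pq : mdist p q <= diam Q.
  by rewrite -lee_fin fineK//; exact: mdist_le_ediam.
have := metric_triangle x p y; have := metric_triangle p q y.
by rewrite (metric_sym q y); lra.
Qed.

(** For r >= 2 diam(E), the ball of radius 3/2 diam(E) is in the admissible range and already
    contains [E]. *)
Lemma Reg1_upper C E x r : Reg1 C E -> E x -> 0 < r ->
  (hausdorff1 (ball x r `&` E) <= (C * r)%:E)%E.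
Proof.
move=> [C1 E0 cE HE] Ex r0.
have [rE|Er] := ltP r%:E (2%:E * ediam E)%E.
  by have /andP[] := HE x r Ex r0 rE.
have Efin : ediam E \is a fin_num.
  rewrite ge0_fin_numE ?ediam_ge0// ltNge leye_eq; apply/negP => /eqP Ey.
  by move: Er; rewrite Ey gt0_muley ?lte_fin// leye_eq.
have dE : ediam E = (diam E)%:E by rewrite fineK.
have D0 : 0 < diam E by rewrite -lte_fin -dE.
have r2 : 2 * diam E <= r by rewrite -lee_fin EFinM -dE.
have s0 : 0 < 3 / 2 * diam E by rewrite mulr_gt0.
have sE : ((3 / 2 * diam E)%:E < 2%:E * ediam E)%E.
  by rewrite dE -EFinM lte_fin; lra.
have /andP[_ up] := HE x _ Ex s0 sE.
apply: le_trans (le_trans (le_hausdorff1 _) up) _.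
  move=> y [_ Ey]; split => //; rewrite ballEmdist /=.
  have : mdist x y <= diam E by rewrite -lee_fin -dE; exact: mdist_le_ediam.
  by lra.
by rewrite lee_fin; nra.
Qed.

Record cube_estimates C c E Q : Prop := CubeEstimates {
  cube_sub : Q `<=` E ;
  cube_measurable : measurable (Q : set (borel X)) ;
  cube_nonempty : Q !=set0 ;
  cube_ediam : ediam Q \is a fin_num ;
  cube_diam_gt0 : 0 < diam Q ;
  cube_lower : ((c ^+ 2 / C * diam Q)%:E <= hausdorff1 Q)%E }.

(** A cube of generation j contains the trace of a ball of radius c 2^-j, of mass at least c 2^-j /
    C, and has diameter at most 2^-j / c; hence the factor c^2 / C. Its diameter is positive because
    upper regularity bounds its mass by C diam(Q). *)
Lemma cube_estimatesP C c E Delta Q : 0 < c < 1 -> Reg1 C E ->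
  dyadic_system c E Delta -> cubes E Delta Q -> cube_estimates C c E Q.
Proof.
move=> /andP[c0 c1] regE HD [j gj DQ].
have [C1 E0 cE HE] := regE.
have C0 : 0 < C by lra.
have [QE mQ] := dyadic_borel HD gj DQ.
have [x Ex xQ] := dyadic_ball HD gj DQ.
have Qdiam := dyadic_diam HD gj DQ.
set s := (2 : R) ^ (- j) in xQ Qdiam.
have s0 : 0 < s by rewrite exprz_gt0.
have r0 : 0 < c * s by rewrite mulr_gt0.
(* In the bounded case the first generation n satisfies 2^-n <= diam(E), so c 2^-j is an admissible
   radius. *)
have rE : ((c * s)%:E < 2%:E * ediam E)%E.
  case: gj => [->|[n /andP[nE _] nj]]; first by rewrite gt0_muley ?lte_fin// ltry.
  have sE : (s%:E <= ediam E)%E.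
    apply: le_trans nE; rewrite lee_fin /s ler_weXz2l ?ler1n//.
    by rewrite lerN2.
  apply: (@lt_le_trans _ _ s%:E); first by rewrite lte_fin; nra.
  apply: (le_trans sE); rewrite -{1}[ediam E]mul1e lee_wpmul2r ?ediam_ge0//.
  by rewrite lee_fin; lra.
have low : ((C^-1 * (c * s))%:E <= hausdorff1 Q)%E.
  have /andP[lo _] := HE x _ Ex r0 rE.
  exact: le_trans lo (le_hausdorff1 xQ).
have Qfin : ediam Q \is a fin_num.
  by rewrite ge0_fin_numE ?ediam_ge0// (le_lt_trans Qdiam)// ltry.
have Ds : diam Q <= c^-1 * s by rewrite -lee_fin fineK.
have Qx : Q x.
  by apply: xQ; split => //; rewrite ballEmdist /= mdistxx.
have up : (hausdorff1 Q <= (C * diam Q)%:E)%E.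
  apply/lee_addgt0Pr => e e0.
  have d0 : 0 < diam Q + e / C by rewrite ltr_wpDl ?diam_ge0// divr_gt0.
  have := Reg1_upper regE Ex d0; rewrite -EFinD mulrDr mulrCA divff ?gt_eqF// mulr1.
  apply: le_trans; apply: le_hausdorff1 => y Qy; split; last exact: QE.
  rewrite ballEmdist /=; apply: (@le_lt_trans _ _ (diam Q)).
    by rewrite -lee_fin fineK//; exact: mdist_le_ediam.
  by rewrite ltrDl divr_gt0.
split => //; first by exists x.
  have : 0 < C^-1 * (c * s) by rewrite mulr_gt0// invr_gt0.
  have := le_trans low up; rewrite lee_fin => h1 h2.
  by rewrite -(pmulr_rgt0 _ C0); exact: lt_le_trans h1.
apply: le_trans low; rewrite lee_fin mulrC mulrA [leRHS]mulrC ler_pM2r ?invr_gt0//.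
have := ler_wpM2l (sqr_ge0 c) Ds.
rewrite expr2 -!mulrA [c * (c^-1 * s)]mulrA divff ?gt_eqF// mul1r.
by rewrite mulrC -mulrA.
Qed.

(** The case [K = 7] gives the estimate of the theorem, and [K = 2] the comparison of both
    coefficients on the same set. *)
Lemma iota11_dilate_le C c E Q (K : R) : 0 < C -> 0 < c -> 2 <= K <= 7 ->
  Reg1 C E -> cube_estimates C c E Q ->
  (iota11 (dilate E 2 Q) <=
    (4800 * 8 * 13 * 13 * C * (14 * C) / (c ^+ 2 / C) ^+ 2)%:E *
      kappa (dilate E K Q))%E.
Proof.
move=> C0 c0 /andP[K2 K7] regE [QE mQ [q Qq] Qfin D0 low].
have [_ _ cE _] := regE.
have sub2K := @dilateS E 2 K Q K2.
have sub2 : Q `<=` dilate E 2 Q by apply: sub_dilate => //; rewrite ler1n.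
have dist13 x y : dilate E K Q x -> dilate E K Q y -> mdist x y <= 13 * diam Q.
  move=> Kx Ky; apply: (le_trans (mdist_dilate Qfin Kx Ky)).
  by rewrite ler_wpM2r ?diam_ge0//; lra.
have balls (p : X) (r : R) : dilate E K Q p -> 0 < r ->
    (hausdorff1 (dilate E K Q `&` ball p r) <= (C * r)%:E)%E.
  move=> [Ep _] r0; apply: le_trans (Reg1_upper regE Ep r0).
  by apply: le_hausdorff1 => z [[Ez _] pz].
apply: (@iota11_le_kappa _ _ _ _ C (c ^+ 2 / C) (14 * C) (diam Q)) => //.
- by rewrite divr_gt0// exprn_gt0.
- exact: measurable_dilate.
- exact: measurable_dilate.
- have fin2 : ediam (dilate E 2 Q) \is a fin_num.
    rewrite ge0_fin_numE ?ediam_ge0//.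
    apply: (@le_lt_trans _ _ (13 * diam Q)%:E); last exact: ltry.
    apply: ediam_le; first by rewrite mulr_ge0// diam_ge0.
    by move=> x y /sub2K ? /sub2K; exact: dist13.
  rewrite fine_le//; apply: ereal_sup_le => _ [->|[[x y] [Sx Sy] <-]]; first by left.
  by right; exists (x, y) => //; split; exact: sub2.
- exact: le_trans low (le_hausdorff1 sub2).
(* Distances in the dilate are at most 13 diam(Q), so an open ball of radius 14 diam(Q) contains
   it. *)
- have Kq : dilate E K Q q by apply: sub2K; exact: sub2.
  have r0 : 0 < 14 * diam Q by rewrite mulr_gt0.
  apply: (@le_trans _ _ (C * (14 * diam Q))%:E); last by rewrite mulrCA mulrA.
  apply: le_trans (balls q _ Kq r0); apply: le_hausdorff1 => z Kz; split => //.
  by rewrite ballEmdist /=; have := dist13 _ _ Kq Kz; lra.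
Qed.

Lemma kappa_dilate_le C c E Q : 0 < C -> 0 < c ->
  Reg1 C E -> cube_estimates C c E Q ->
  ((3^-1)%:E * kappa (dilate E 2 Q) <= iota11 (dilate E 2 Q))%E.
Proof.
move=> C0 c0 regE [QE mQ [q Qq] Qfin D0 low]; have [_ _ cE _] := regE.
have sub2 : Q `<=` dilate E 2 Q by apply: sub_dilate => //; rewrite ler1n.
apply: kappa_le_iota11; first exact: measurable_dilate.
  apply: lt_le_trans (le_hausdorff1 sub2); apply: lt_le_trans low.
  by rewrite lte_fin mulr_gt0// divr_gt0// exprn_gt0.
(* Points of the double of [Q] are at most 3 diam(Q) apart, so a ball of radius 4 diam(Q) bounds its
   mass. *)
have r0 : 0 < 4 * diam Q by rewrite mulr_gt0.
apply: (@le_lt_trans _ _ (C * (4 * diam Q))%:E); last exact: ltry.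
apply: le_trans (Reg1_upper regE (QE _ Qq) r0).
apply: le_hausdorff1 => z Kz; split; last by case: Kz.
rewrite ballEmdist /=; have := mdist_dilate Qfin (sub2 _ Qq) Kz; lra.
Qed.

Local Open Scope ereal_scope.

Lemma esumZl_le (I : choiceType) (S : set I) (a : I -> \bar R) (k : R) :
  (0 <= k)%R -> (forall i, 0 <= a i) ->
  \esum_(i in S) (k%:E * a i) <= k%:E * \esum_(i in S) a i.
Proof.
move=> k0 a0; apply: ge_ereal_sup => _ [F FS <-].
rewrite -ge0_mule_fsumr//; apply: lee_wpmul2l; first by rewrite lee_fin.
by apply: ereal_sup_ubound; exists F.
Qed.

(** The packing constant is multiplied by [k], the exponent being 1. *)
Lemma GLem_le c E (h1 h2 : set X -> \bar R) (k : R) : (0 <= k)%R ->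
  (forall S, 0 <= h1 S) -> (forall S, 0 <= h2 S) ->
  (forall Delta, dyadic_system c E Delta -> forall Q, cubes E Delta Q ->
    h1 (dilate E 2 Q) <= k%:E * h2 (dilate E 2 Q)) ->
  GLem c E h2 1 -> GLem c E h1 1.
Proof.
move=> k0 h10 h20 h12 [M HM]; exists (k * M)%R => Delta HD Q0 cQ0.
apply: (@le_trans _ _ (\esum_(Q in subcubes E Delta Q0)
    (k%:E * (h2 (dilate E 2 Q) `^ 1 * hausdorff1 Q)))).
  apply: le_esum => Q [cQ _]; rewrite !poweRe1// muleA.
  by rewrite lee_wpmul2r ?hausdorff1_ge0//; exact: h12 HD _ cQ.
apply: (le_trans (esumZl_le _ _ _)) => //.
  by move=> Q; rewrite mule_ge0 ?poweR_ge0 ?hausdorff1_ge0.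
by rewrite EFinM -muleA lee_wpmul2l ?lee_fin//; exact: HM.
Qed.

End regular_sets.

Theorem theorem4p17 (R : realType) (c0 : R -> R) (Hc0 : dyadic_constants c0)
    (cE : R) (HcE : 1 <= cE) :
  exists C : R, 1 <= C /\
    forall (X : pmetricType R) (E : set X), Reg1 cE E ->
    [/\ GLem (c0 cE) E (@kappa R X) 1 <-> GLem (c0 cE) E (@iota11 R X) 1,
        forall Delta, dyadic_system (c0 cE) E Delta ->
          forall Q, cubes E Delta Q ->
            ((3^-1)%:E * kappa (dilate E 2 Q) <= iota11 (dilate E 2 Q) /\
             iota11 (dilate E 2 Q) <= C%:E * kappa (dilate E 7 Q))%E &
        complete_space X -> quasiconvex X -> doubling X ->
          GLem (c0 cE) E (@kappa R X) 1 \/ GLem (c0 cE) E (@iota11 R X) 1 ->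
          uniformly_1_rectifiable (c0 cE) E].
Proof.
have [/andP[c00 c01] _] := Hc0 _ HcE.
have C0 : 0 < cE by lra.
set c := c0 cE in c00 c01 *.
(* As [c] is a function of [cE], this constant depends on [cE] alone; the maximum with 1 makes it at
   least 1. *)
set K := 4800 * 8 * 13 * 13 * cE * (14 * cE) / (c ^+ 2 / cE) ^+ 2.
exists (Num.max 1 K); split; first by rewrite le_max lexx.
have K0 : 0 <= Num.max 1 K by rewrite le_max ler01.
have c01' : 0 < c < 1 by rewrite c00 c01.
move=> X E regE.
have upper (k : R) Delta Q : 2 <= k <= 7 -> dyadic_system c E Delta -> cubes E Delta Q ->
    (iota11 (dilate E 2 Q) <= (Num.max 1 K)%:E * kappa (dilate E k Q))%E.
  move=> k27 HD cQ; have H := cube_estimatesP c01' regE HD cQ.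
  apply: (le_trans (iota11_dilate_le C0 c00 k27 regE H)).
  by apply: lee_wpmul2r; [exact: kappa_ge0|rewrite lee_fin le_max -/K lexx orbT].
have lower Delta Q : dyadic_system c E Delta -> cubes E Delta Q ->
    ((3^-1)%:E * kappa (dilate E 2 Q) <= iota11 (dilate E 2 Q))%E.
  move=> HD cQ; have H := cube_estimatesP c01' regE HD cQ.
  exact: kappa_dilate_le C0 c00 regE H.
have GLem_iff : GLem c E (@kappa R X) 1 <-> GLem c E (@iota11 R X) 1.
  split; apply: GLem_le; try exact: kappa_ge0; try exact: iota11_ge0.
  - exact: K0.
  - by move=> Delta HD Q cQ; apply: upper HD cQ; lra.
  - exact: (ler0n R 3).
  - move=> Delta HD Q cQ; have := lower _ _ HD cQ.
    by rewrite lee_pdivrMl.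
split => //.
  move=> Delta HD Q cQ; split; first exact: lower HD cQ.
  by apply: upper HD cQ; lra.
(* The fourth description of uniform rectifiability is [GLem] for [kappa] with exponent 1. *)
by move=> _ _ _ [H|/GLem_iff H]; apply: Or44.
Qed.
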